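(* Let $L\ge2$ be even, $p=L/2$, and $h\in\mathbb{R}$. The following are equivalent: (a) there exist real $\gamma_1,\beta_1,\dots,\gamma_p,\beta_p$ such that $e^{-i\beta_pH_1}e^{-i\gamma_pH_2}\cdots e^{-i\beta_1H_1}e^{-i\gamma_1H_2}|+\cdots+\rangle$ equals, up to a phase, the ground state $|G_h\rangle$ of $H_T(h)=H_1+hH_2$ on $L$ qubits; (b) the system of $L/2$ equations $f_{\rm proj}(k)=0$, $k\in \mathrm{NS}_+$, in the $L$ real unknowns $\gamma_1,\beta_1,\dots,\gamma_p,\beta_p$, admits at least one solution.
   Context: $X_j,Y_j,Z_j$ are Pauli operators on $(\mathbb{C}^2)^{\otimes L}$, periodic boundary conditions ($Z_{L+1}=Z_1$). $H_1=-\sum_{j=1}^L Z_jZ_{j+1}$, $H_2=-\sum_{j=1}^L X_j$. $X|+\rangle=|+\rangle$. $|G_h\rangle$ is the normalized lowest-energy eigenvector of $H_T(h)$ in the sector $\prod_{j=1}^LX_j=+1$; it is a ground state of $H_T(h)$, and the unique one (up to phase) if $h\neq0$. $\mathrm{NS}_+=\{2\pi(n+1/2)/L:\ n=0,\dots,L/2-1\}\subset(0,\pi)$. For $k\in \mathrm{NS}_+$ define, with values in the Riemann sphere (right-hand sides read as Möbius transformations), $f_0(k)=\frac1{i\tan(k/2)}$, $$f_{2j+1}(k)=e^{-4i\gamma_{j+1}}\frac{1-i\tan(k/2)f_{2j}(k)}{f_{2j}(k)-i\tan(k/2)}\ (0\le j\le p-1),\qquad f_{2j}(k)=e^{-4i\beta_j}\frac{1+i\tan(k/2)f_{2j-1}(k)}{f_{2j-1}(k)+i\tan(k/2)}\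 (1\le j\le p),$$ $$f_{\rm proj}(k)=\frac{iK_{h0}(k)+f_{2p}(k)}{1+iK_{h0}(k)f_{2p}(k)},\qquad K_{h0}(k)=\tan\tfrac12\left[\arctan\tfrac{h-\cos k}{\sin k}+\arctan\tfrac{1}{\tan k}\right]\quad (1/\tan k:=\cot k).$$ *)

(* Defs.v *)
From HB Require Import structures.
From mathcomp Require Import all_boot all_order all_algebra.
From mathcomp Require Import complex.
From mathcomp Require Import all_classical all_reals all_analysis.

Set Implicit Arguments.
Unset Strict Implicit.
Unset Printing Implicit Defensive.

Import Order.TTheory GRing.Theory Num.Theory.
Import numFieldNormedType.Exports.

Local Open Scope classical_set_scope.
Local Open Scope complex_scope.
Local Open Scope ring_scope.

(* The limit is taken in the normed module of matrices, i.e., entrywise. *)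
Definition expmx (K : numFieldType) (n : nat) (A : 'M[K]_n) : 'M[K]_n :=
  limn (series (fun k => k`!%:R^-1 *: A ^+ k)).

Definition expi (R : realType) (t : R) : R[i] := cos t +i* sin t.

(* (C^2)^{\otimes L} is the space of column vectors indexed by the           *)
(* computational basis, the bit strings {ffun 'I_L -> 'I_2}; qdim L = 2 ^ L. *)
(* Sites are numbered from 0 to L - 1.                                       *)
Definition qdim (L : nat) : nat := #|{: {ffun 'I_L -> 'I_2}}|.

Definition bits (L : nat) (a : 'I_(qdim L)) : {ffun 'I_L -> 'I_2} := enum_val a.

Section Spins.
Variable R : realType.
Local Notation C := R[i].
Variable L : nat.

Definition tensor_mx (A : 'I_L -> 'M[C]_2) : 'M[C]_(qdim L) :=
  \matrix_(a, b) \prod_(j < L) A j (bits a j) (bits b j).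

Definition tensor_vec (v : 'I_L -> 'cV[C]_2) : 'cV[C]_(qdim L) :=
  \col_a \prod_(j < L) v j (bits a j) 0.

Definition pauliX : 'M[C]_2 := \matrix_(a, b) (a != b)%:R.
Definition pauliZ : 'M[C]_2 := \matrix_(a, b) ((-1) ^+ a *+ (a == b)).

Definition at_site (A : 'M[C]_2) (j : 'I_L) : 'M[C]_(qdim L) :=
  tensor_mx (fun i => if i == j then A else 1%:M).

Definition X_ (j : 'I_L) : 'M[C]_(qdim L) := at_site pauliX j.
Definition Z_ (j : 'I_L) : 'M[C]_(qdim L) := at_site pauliZ j.

(* [ordS j] is j + 1 modulo L: periodic boundary conditions. *)
Definition H1 : 'M[C]_(qdim L) := - \sum_(j < L) Z_ j *m Z_ (ordS j).
Definition H2 : 'M[C]_(qdim L) := - \sum_(j < L) X_ j.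
Definition HT (h : R) : 'M[C]_(qdim L) := H1 + h%:C *: H2.

Definition parity : 'M[C]_(qdim L) := \prod_(j < L) X_ j.

Definition plus : 'cV[C]_2 := const_mx ((Num.sqrt 2)^-1)%:C.
Definition all_plus : 'cV[C]_(qdim L) := tensor_vec (fun=> plus).

Definition normalized (v : 'cV[C]_(qdim L)) : Prop :=
  \sum_a `|v a 0| ^+ 2 = 1.

(* [G] is |G_h>; the eigenvalues of the Hermitian matrix [HT h] are real. *)
Definition is_sector_ground_state (h : R) (G : 'cV[C]_(qdim L)) : Prop :=
  exists E : R,
    [/\ normalized G, parity *m G = G, HT h *m G = E%:C *: G &
      forall (E' : R) (v : 'cV[C]_(qdim L)),
        v != 0 -> parity *m v = v -> HT h *m v = E'%:C *: v -> E <= E'].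

(* The parameters gamma_{j+1} and beta_{j+1} are gamma`_j and beta`_j. *)
Fixpoint qaoa_state (gamma beta : seq R) (p : nat) : 'cV[C]_(qdim L) :=
  if p is j.+1 then
    expmx ((- 'i * (beta`_j)%:C) *: H1) *m
      (expmx ((- 'i * (gamma`_j)%:C) *: H2) *m qaoa_state gamma beta j)
  else all_plus.

Definition NSplus : set R :=
  [set 2 * pi * (n%:R + 2^-1) / L%:R | n in [set n : nat | (n < L./2)%N]].

End Spins.

Section RiemannSphere.
Variable R : realType.
Local Notation C := R[i].

(* [None] is the point at infinity. *)
Definition sphere : Type := option C.

(* z |-> (a z + b) / (c z + d), meaningful when a d - b c != 0, which holds  *)
(* for all the instances below.                                              *)
Definition mobius (a b c d : C) (z : sphere) : sphere :=
  match z with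
  | Some w => if c * w + d == 0 then None else Some ((a * w + b) / (c * w + d))
  | None => if c == 0 then None else Some (a / c)
  end.

Definition rotate (t : R) (z : sphere) : sphere := mobius (expi t) 0 0 1 z.

Definition itan (k : R) : C := 'i * (tan (k / 2))%:C.

(* f_{2j+1}(k) as a function of f_{2j}(k), with g = gamma_{j+1} *)
Definition gamma_step (g k : R) (z : sphere) : sphere :=
  rotate (- (4 * g)) (mobius (- itan k) 1 1 (- itan k) z).

(* f_{2j}(k) as a function of f_{2j-1}(k), with b = beta_j *)
Definition beta_step (b k : R) (z : sphere) : sphere :=
  rotate (- (4 * b)) (mobius (itan k) 1 1 (itan k) z).

(* f_{2p}(k) *)
Fixpoint f_even (gamma beta : seq R) (k : R) (p : nat) : sphere :=
  if p is j.+1 then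
    beta_step beta`_j k (gamma_step gamma`_j k (f_even gamma beta k j))
  else Some (itan k)^-1.

Definition Kh0 (h k : R) : R :=
  tan ((atan ((h - cos k) / sin k) + atan (cos k / sin k)) / 2).

Definition f_proj (h : R) (gamma beta : seq R) (p : nat) (k : R) : sphere :=
  let iK := 'i * (Kh0 h k)%:C in mobius 1 iK iK 1 (f_even gamma beta k p).

End RiemannSphere.

(* Main.v *)
Require Import Defs.
From HB Require Import structures.
From mathcomp Require Import all_boot all_order all_algebra.
From mathcomp Require Import ring lra zify complex.
From mathcomp Require Import all_classical all_reals all_analysis.
Import Order.TTheory GRing.Theory Num.Theory.
Import numFieldNormedType.Exports.

Set Implicit Arguments.
Unset Strict Implicit.
Unset Printing Implicit Defensive.
Local Open Scope classical_set_scope.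
Local Open Scope complex_scope.
Local Open Scope sesquilinear_scope.
Local Open Scope ring_scope.

(* Starting from the fermionic vacuum |+...+>, the evolution stays in the span of the
   states obtained by creating pairs of fermions of momenta k and -k, k in NS_+.  This
   span is isometric to the tensor product of L/2 copies of C^2, and H1, H2 act on it as
   sums of traceless 2 x 2 Hermitian matrices, one for each k.  So the QAOA state is a
   product of vectors w_k of C^2, and f_{2j+1}(k), f_{2j}(k) are the ratios of the two
   components of w_k in the eigenbases of the blocks of H2 and H1.  By Perron-Frobenius
   in the X basis, a lowest eigenvector of H_T(h) in the sector of parity +1 cannot be
   orthogonal to |+...+>, which forces |G_h> into the span of pair states; there it is the
   product of the ground vectors of the blocks.  Hence (a) says that every w_k is
   proportional to the k-th ground vector, and f_proj(k), the ratio of the components of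
   w_k in the eigenbasis of the block of H_T(h), vanishes exactly in this case. *)

(** * Exponentials of Hermitian matrices *)

(** Two obstacles shape the proof. The bond from the last site to the first is not quadratic in the
    fermions: it carries the parity operator. So [H1] agrees with a quadratic form only where the
    parity is +1, and there with antiperiodic boundary conditions, which is the origin of the
    half-integer momenta in NS_+. Moreover the pair states span only 2^(L/2) of the 2^(L-1)
    dimensions of that sector, so diagonalising the blocks does not show that the sector minimum is
    reached in their span; the overlap argument settles this without examining unpaired excitations.
    All block vectors lie in one plane, so any two eigenbases differ by a rotation e^{iaX}. Each
    change of basis is therefore one Moebius map whose coefficient is a tangent, and K_{h0} is the
    tangent of a difference of two angles. The recursion keeps only ratios and forgets one phase for
    each k. These phases multiply into the single global phase that (a) allows. *)

Section Exponential.
Variable R : realType.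
Local Notation C := R[i].
(* The topology on complex numbers is inferred from this structure, not from [R[i]]. *)
Let K : numFieldType := R[i].

Lemma cvg_complex (u v : R^nat) (a b : R) :
  u @ \oo --> a -> v @ \oo --> b ->
  (fun n => (u n +i* v n : K)) @ \oo --> (a +i* b : K).
Proof.
move=> ua vb; apply/cvgrPdist_lt => -[e1 e2]; rewrite ltcE /= => /andP[/eqP -> e0].
have e20 : 0 < e1 / 2 by rewrite divr_gt0.
move/cvgrPdist_lt/(_ _ e20) : ua => ua; move/cvgrPdist_lt/(_ _ e20) : vb => vb.
near=> n.
have -> : (a +i* b : C) - (u n +i* v n) =
    (a - u n)%:C + 'i%C * (b - v n)%:C by simpc.
apply: le_lt_trans (ler_normD _ _) _.
rewrite normrM !normc_def /= expr0n expr1n /= !add0r !addr0 !sqrtr_sqr sqrtr1 mul1r.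
rewrite -raddfD /= ltcR (splitr e1).
apply: ltrD; first by near: n.
by near: n.
Unshelve. all: by end_near. Qed.

Lemma expi_series (t : R) :
  series (fun k => (k`!%:R)^-1 * ('i * t%:C) ^+ k : K) @ \oo --> (expi t : K).
Proof.
have -> : series (fun k => (k`!%:R)^-1 * ('i * t%:C) ^+ k : K) =
    (fun n => series (cos_coeff t) n +i* series (sin_coeff t) n).
  apply/funext => n; rewrite !seriesEnat /=.
  elim: n => [|n IH]; first by rewrite !big_geq.
  rewrite !big_nat_recr //= IH.
  set a := (X in _ +i* _ + X = _).
  suff -> : a = cos_coeff t n +i* sin_coeff t n by simpc.
  rewrite /a /cos_coeff /sin_coeff /= exprMn -rmorphXn /=.
  have -> : (n`!%:R : C) = (n`!%:R)%:C by rewrite rmorph_nat.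
  rewrite -fmorphV mulrCA -rmorphM /=.
  have -> : ('i : C) ^+ n = ((~~ odd n)%:R * (-1) ^+ n./2) +i* ((odd n)%:R * (-1) ^+ n.-1./2).
    rewrite -{1}(odd_double_half n) exprD -mul2n exprM sqrCi.
    have -> : n.-1./2 = if odd n then n./2 else n.-1./2.
      by case: (boolP (odd n)) => // on; rewrite -{1}(odd_double_half n) on /= doubleK.
    have -> : (-1 : C) ^+ n./2 = ((-1) ^+ n./2)%:C.
      by rewrite rmorphXn /= rmorphN rmorph1.
    case: (odd n) => /=; rewrite ?expr0 ?expr1 ?mul0r ?mul1r //.
    by rewrite -complexiE; simpc.
  by simpc; rewrite -!mulrA ![_^-1 * _]mulrC.
rewrite /expi cos.unlock sin.unlock.
by apply: cvg_complex; [exact: is_cvg_series_cos_coeff|exact: is_cvg_series_sin_coeff].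
Qed.

Lemma expiD (s t : R) : expi (s + t) = expi s * expi t :> C.
Proof. by rewrite /expi cosD sinD; simpc; rewrite [sin s * _ + _]addrC. Qed.

Lemma expi0 : expi 0 = 1 :> C.
Proof. by rewrite /expi cos0 sin0. Qed.

Lemma expi_sum (I : Type) (r : seq I) (F : I -> R) :
  expi (\sum_(i <- r) F i) = \prod_(i <- r) expi (F i) :> C.
Proof. by elim/big_rec2: _ => [|i x y _ <-]; rewrite ?expi0 // expiD. Qed.

Lemma conj_expi (t : R) : (expi t)^* = expi (- t) :> C.
Proof. by rewrite /expi cosN sinN. Qed.

Lemma expiVr (t : R) : expi t * expi (- t) = 1 :> C.
Proof. by rewrite -expiD subrr expi0. Qed.

Lemma norm_expi (t : R) : `|expi t : C| = 1.
Proof. by rewrite normc_def /= cos2Dsin2 sqrtr1. Qed.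

Lemma cvg_mx m n (f : nat -> 'M[K]_(m, n)) (M : 'M[K]_(m, n)) :
  (forall i j, (fun k => f k i j) @ \oo --> M i j) -> f @ \oo --> M.
Proof.
move=> fM A [P PM PA]; rewrite /nbhs /=.
suff : \forall k \near \oo, forall i j, P i j (f k i j).
  by apply: filterS => k Pk; apply: PA.
apply: filter_forall => i; apply: filter_forall => j; exact: (fM i j).
Qed.

(** Every entry of a partial sum is a fixed linear combination, with coefficients [S' i l * S l j],
    of the scalar exponential series at the eigenvalues. This also supplies the convergence, about
    which [limn] alone says nothing. *)
Lemma expmx_diagonalizable n (A S S' : 'M[C]_n) (d : 'I_n -> R) (t : R) :
  S *m S' = 1%:M -> A = S' *m diag_mx (\row_i (d i)%:C) *m S ->
  expmx ((- 'i * t%:C) *: A) = S' *m diag_mx (\row_i expi (- (t * d i))) *m S.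
Proof.
move=> SS' ->; rewrite /expmx; apply: cvg_lim.
  apply: norm_hausdorff.
set D := diag_mx _.
have cA : (- 'i * t%:C) *: (S' *m D *m S) =
    S' *m diag_mx (\row_i ('i * (- (t * d i))%:C)) *m S.
  have -> : diag_mx (\row_i ('i * (- (t * d i))%:C)) = (- 'i * t%:C) *: D.
    apply/matrixP => i j; rewrite !mxE.
    case: eqP => _; rewrite ?mulr0n ?mulr0 // !mulr1n.
    by rewrite rmorphN rmorphM /= mulrN !mulNr mulrA.
  by rewrite -scalemxAr -scalemxAl.
have powE k : ((- 'i * t%:C) *: (S' *m D *m S)) ^+ k =
    S' *m diag_mx (\row_i ('i * (- (t * d i))%:C) ^+ k) *m S.
  rewrite cA; elim: k => [|k IH].
    rewrite expr0 [X in diag_mx X](_ : _ = const_mx 1); last first.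
      by apply/rowP => i; rewrite !mxE expr0.
    by rewrite diag_const_mx mulmx1 (mulmx1C SS').
  rewrite exprS IH -mulmxE !mulmxA -[_ *m S *m S']mulmxA SS' mulmx1.
  congr (_ *m S); rewrite -mulmxA; congr (_ *m _).
  apply/matrixP => i j; rewrite mul_diag_mx !mxE.
  by case: eqP => _; rewrite ?mulr0n ?mulr0 // !mulr1n exprS.
apply: cvg_mx => i j.
have -> : (fun k => series (fun k => k`!%:R^-1 *: ((- 'i * t%:C) *: (S' *m D *m S)) ^+ k) k i j)
   = (fun k => \sum_l (S' i l * S l j) * series (fun k => k`!%:R^-1 * ('i * (- (t * d l))%:C) ^+ k) k).
  apply/funext => k; rewrite !seriesEnat /= summxE.
  under [RHS]eq_bigr do rewrite seriesEnat /= mulr_sumr.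
  rewrite exchange_big /=; apply: eq_bigr => m _.
  rewrite powE mxE mxE mulr_sumr; apply: eq_bigr => l _.
  by rewrite mul_mx_diag !mxE; ring.
rewrite mxE; under [X in _ --> X]eq_bigr => l _.
  rewrite mul_mx_diag !mxE -mulrA [_ * S l j]mulrC mulrA; over.
have -> : (fun k => \sum_l (S' i l * S l j) * series (fun k => k`!%:R^-1 * ('i * (- (t * d l))%:C) ^+ k) k)
   = \sum_l (fun k => (S' i l * S l j) * series (fun k => k`!%:R^-1 * ('i * (- (t * d l))%:C) ^+ k : K) k).
  by apply/funext => k; rewrite fct_sumE.
elim/big_rec2: _ => [|l x f _ fx]; first exact: cvg_cst.
apply: cvgD fx.
by apply: cvgM; [exact: cvg_cst|exact: expi_series].
Qed.

Lemma expmx_eigenvector n (A : 'M[C]_n) (v : 'cV[C]_n) (d t : R) :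
  A^t* = A -> A *m v = d%:C *: v ->
  expmx ((- 'i * t%:C) *: A) *m v = expi (- (t * d)) *: v.
Proof.
move=> hA Av.
have hermA : A \is hermsymmx by apply/is_hermitianmxP; rewrite expr0 scale1r hA.
have /orthomx_spectralP := hermitian_normalmx hermA.
set S := spectralmx A; set D := spectral_diag A => AE.
have SS : S *m invmx S = 1%:M by rewrite mulmxV // spectral_unit.
have Dreal i : D 0 i = (complex.Re (D 0 i))%:C.
  by rewrite RRe_real //; apply: (mxOverP (hermitian_spectral_diag_real hermA)).
have AE' : A = invmx S *m diag_mx (\row_i (complex.Re (D 0 i))%:C) *m S.
  have -> : \row_i (complex.Re (D 0 i))%:C = D by apply/rowP => i; rewrite mxE -Dreal.
  exact: AE.
rewrite (expmx_diagonalizable t SS AE') -!mulmxA.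
have -> : diag_mx (\row_i expi (- (t * complex.Re (D 0 i)))) *m (S *m v)
    = expi (- (t * d)) *: (S *m v).
  have : diag_mx (\row_i (complex.Re (D 0 i))%:C) *m (S *m v) = d%:C *: (S *m v).
    rewrite scalemxAr -Av {1}AE' !mulmxA SS mul1mx; congr (_ *m _ *m _).
  (* In the eigenbasis each coordinate of [v] is either 0 or belongs to the eigenvalue d, so all
     nonzero coordinates acquire the same phase. *)
  move=> /matrixP E; apply/matrixP => i j; have := E i j.
  rewrite !mul_diag_mx !mxE; set y := \sum_(_ < _) _.
  have [->|y0] := eqVneq y 0; first by rewrite !mulr0.
  by move/(mulIf y0)/complexI => ->.
by rewrite -scalemxAr mulmxA mulVmx ?spectral_unit // mul1mx.
Qed.

End Exponential.

(** * Tensor products and Jordan--Wigner fermions *)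

Section Tensors.
Variables (R : realType) (L : nat).
Local Notation C := R[i].
Implicit Types (A B : 'I_L -> 'M[C]_2) (v : 'I_L -> 'cV[C]_2).

Lemma bits_bij : bijective (@bits L).
Proof. by exists enum_rank; [exact: enum_valK|exact: enum_rankK]. Qed.

Lemma sum_bits (V : nmodType) (F : {ffun 'I_L -> 'I_2} -> V) :
  \sum_a F (bits a) = \sum_s F s.
Proof. by rewrite [RHS](reindex (@bits L)) //; exact: onW_bij bits_bij. Qed.

Lemma eq_tensor_mx A B : A =1 B -> tensor_mx A = tensor_mx B.
Proof. by move=> AB; apply/matrixP => a b; rewrite !mxE; apply: eq_bigr => j _; rewrite AB. Qed.

Lemma eq_tensor_vec v w : v =1 w -> tensor_vec v = tensor_vec w.
Proof. by move=> vw; apply/matrixP => a b; rewrite !mxE; apply: eq_bigr => j _; rewrite vw. Qed.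

Lemma tensor_mxM A B :
  tensor_mx A *m tensor_mx B = tensor_mx (fun j => A j *m B j).
Proof.
apply/matrixP => a b; rewrite !mxE.
under [RHS]eq_bigr do rewrite mxE.
rewrite bigA_distr_bigA /= -sum_bits; apply: eq_bigr => c _.
by rewrite !mxE big_split.
Qed.

Lemma tensor_mxV A v :
  tensor_mx A *m tensor_vec v = tensor_vec (fun j => A j *m v j).
Proof.
apply/matrixP => a b; rewrite !mxE.
under [RHS]eq_bigr do rewrite mxE.
rewrite bigA_distr_bigA /= -sum_bits; apply: eq_bigr => c _.
by rewrite !mxE big_split.
Qed.

Lemma prod_delta (I J : finType) (f g : {ffun I -> J}) :
  \prod_i (f i == g i)%:R = (f == g)%:R :> C.
Proof.
have [->|/eqP fg] := eqVneq f g; first by rewrite big1 // => i _; rewrite eqxx.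
have [i /negbTE fgi] : exists i, f i != g i.
  apply/existsP; apply: contra_notT fg; rewrite negb_exists => /forallP fg.
  by apply/ffunP => i; apply/eqP; rewrite -[_ == _]negbK.
by rewrite (bigD1 i) //= fgi mul0r.
Qed.

Lemma tensor_mx1 : tensor_mx (fun=> 1%:M) = 1%:M :> 'M[C]_(qdim L).
Proof.
apply/matrixP => a b; rewrite !mxE.
under eq_bigr do rewrite mxE.
by rewrite prod_delta (can_eq (@enum_valK _)).
Qed.

Lemma tensor_mx_adj A : (tensor_mx A)^t* = tensor_mx (fun j => (A j)^t*).
Proof. by apply/matrixP => a b; rewrite !mxE rmorph_prod; apply: eq_bigr => j _; rewrite !mxE. Qed.

(** Multilinearity in one slot. With x = -1 it extracts each anticommutation sign below from the
    only site where it arises. *)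
Lemma tensor_mx_scale (j : 'I_L) (x : C) A B :
    A j = x *: B j -> (forall i, i != j -> A i = B i) ->
  tensor_mx A = x *: tensor_mx B.
Proof.
move=> Aj AB; apply/matrixP => a b; rewrite !mxE.
rewrite [LHS](bigD1 j) //= [X in x * X](bigD1 j) //= Aj !mxE mulrA; congr (_ * _).
by apply: eq_bigr => i ij; rewrite AB.
Qed.

Lemma tensor_vec_scale (c : 'I_L -> C) v :
  tensor_vec (fun j => c j *: v j) = (\prod_j c j) *: tensor_vec v.
Proof.
apply/matrixP => a b; rewrite !mxE -big_split /=.
by apply: eq_bigr => j _; rewrite mxE.
Qed.

Lemma at_site_adj (M : 'M[C]_2) (j : 'I_L) : (at_site M j)^t* = at_site (M^t*) j.
Proof.
rewrite tensor_mx_adj; apply: eq_tensor_mx => i; case: eqP => // _.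
by rewrite trmx1 map_mx1.
Qed.

End Tensors.

(** * Pauli matrices, Jordan--Wigner strings and parity *)

Section Spins.
Variables (R : realType) (L : nat).
Local Notation C := R[i].
Local Notation sx := (pauliX R).
Local Notation sz := (pauliZ R).

Lemma sum_I2 (V : nmodType) (F : 'I_2 -> V) : \sum_i F i = F 0 + F 1.
Proof. by rewrite big_ord_recr big_ord1 /=; congr (F _ + F _); apply/val_inj. Qed.

Lemma I2P (i : 'I_2) : i = 0 \/ i = 1.
Proof. by case: i => -[|[|//]] ?; [left|right]; apply/val_inj. Qed.

Lemma mx2P m (A B : 'M[C]_(2, m)) :
  (forall j, A 0 j = B 0 j) -> (forall j, A 1 j = B 1 j) -> A = B.
Proof. by move=> H0 H1; apply/matrixP => i j; case: (I2P i) => ->. Qed.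

Lemma pauliXX : sx *m sx = 1%:M.
Proof.
by apply: mx2P => j; case: (I2P j) => ->; rewrite !mxE sum_I2 !mxE /=; ring.
Qed.

Lemma pauliZZ : sz *m sz = 1%:M.
Proof.
by apply: mx2P => j; case: (I2P j) => ->; rewrite !mxE sum_I2 !mxE /=; ring.
Qed.

Lemma pauliZX : sz *m sx = - (sx *m sz).
Proof.
by apply: mx2P => j; case: (I2P j) => ->; rewrite !mxE !sum_I2 !mxE /=; ring.
Qed.

Lemma pauliX_adj : sx^t* = sx.
Proof.
by apply: mx2P => j; case: (I2P j) => ->; rewrite !mxE /= ?rmorph1 ?rmorph0.
Qed.

Lemma pauliZ_adj : sz^t* = sz.
Proof.
apply: mx2P => j; case: (I2P j) => ->; rewrite !mxE /= ?mulr1n ?mulr0n ?rmorph0 //.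
  by rewrite expr0 rmorph1.
by rewrite expr1 rmorphN rmorph1.
Qed.

Lemma pauliX_plus : sx *m plus R = plus R.
Proof. by apply: mx2P => j; rewrite !mxE sum_I2 !mxE /=; ring. Qed.

Lemma plus_adj_plus : (plus R)^t* *m plus R = 1%:M.
Proof.
apply/matrixP => i j; rewrite !ord1 !mxE sum_I2 !mxE.
have -> (x : R) : (x%:C)^* = x%:C :> C by rewrite -[RHS]conjc_real.
rewrite -rmorphM -rmorphD /= -mulr2n -invfM -expr2 sqr_sqrtr //.
by rewrite -[X in X%:C]mulr_natl mulfV // pnatr_eq0.
Qed.

(** The tail consists of X rather than Z because both the parity and the vacuum |+...+> belong to
    the X basis. *)
Definition string (M : 'M[C]_2) (j : 'I_L) : 'M[C]_(qdim L) :=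
  tensor_mx (fun i => if (i < j)%N then sx else if i == j then M else 1%:M).

(* The Majorana operators c_j^+ + c_j and c_j^+ - c_j of the Jordan--Wigner
   fermions, whose vacuum is |+...+> (so that X_j = 1 - 2 c_j^+ c_j). *)
Definition maj_a (j : 'I_L) := string sz j.
Definition maj_b (j : 'I_L) := string (sz *m sx) j.

Lemma stringM (M N : 'M[C]_2) j : string M j *m string N j = at_site (M *m N) j.
Proof.
rewrite tensor_mxM; apply: eq_tensor_mx => i; case: ltnP => [ij|_].
  by rewrite pauliXX; case: eqP ij => // ->; rewrite ltnn.
by case: eqP; rewrite ?mulmx1.
Qed.

Lemma string_adj M j : (string M j)^t* = string (M^t*) j.
Proof.
rewrite tensor_mx_adj; apply: eq_tensor_mx => i; case: ifP => _; first exact: pauliX_adj.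
by case: eqP => // _; rewrite trmx1 map_mx1.
Qed.

(** The sign arises at site i alone, where [M] meets the tail of the longer string; at every other
    site the factors commute. *)
Lemma string_anticomm_lt M N (i j : 'I_L) : (i < j)%N -> M *m sx = - (sx *m M) ->
  string M i *m string N j = - (string N j *m string M i).
Proof.
move=> ij MX; rewrite !tensor_mxM -[RHS]scaleN1r; apply: (tensor_mx_scale (j := i)).
  by rewrite ltnn eqxx ij MX scaleN1r.
move=> k ki; rewrite (negbTE ki); case: (ltnP k i) => [lki|_].
  by rewrite (ltn_trans lki ij).
by rewrite mul1mx mulmx1.
Qed.

Lemma string_anticomm M N (i j : 'I_L) : i != j ->
    M *m sx = - (sx *m M) -> N *m sx = - (sx *m N) ->
  string M i *m string N j + string N j *m string M i = 0.
Proof.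
move=> ij MX NX; have [lij|lji|/val_inj eij] := ltngtP i j.
- by rewrite (string_anticomm_lt _ lij MX) addNr.
- by rewrite (string_anticomm_lt _ lji NX) addrN.
- by rewrite eij eqxx in ij.
Qed.

Lemma pauliZXX : (sz *m sx) *m sx = - (sx *m (sz *m sx)).
Proof. by rewrite {1}pauliZX mulNmx mulmxA. Qed.

Lemma pauliZXZX : (sz *m sx) *m (sz *m sx) = - 1%:M.
Proof.
rewrite [X in _ *m X]pauliZX mulmxN -mulmxA [sx *m (sx *m _)]mulmxA pauliXX.
by rewrite mul1mx pauliZZ.
Qed.

Lemma at_site1 (j : 'I_L) : at_site 1%:M j = 1%:M :> 'M[C]_(qdim L).
Proof. by rewrite -tensor_mx1; apply: eq_tensor_mx => i; case: eqP. Qed.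

Lemma at_siteN (M : 'M[C]_2) (j : 'I_L) : at_site (- M) j = - at_site M j.
Proof.
rewrite -[RHS]scaleN1r /at_site; apply: (tensor_mx_scale (j := j)).
  by rewrite eqxx scaleN1r.
by move=> i /negbTE ->.
Qed.

Lemma maj_aa (i j : 'I_L) :
  maj_a i *m maj_a j + maj_a j *m maj_a i = ((i == j)%:R *+ 2)%:M.
Proof.
have [->|ij] := eqVneq i j.
  by rewrite stringM pauliZZ at_site1 mulr2n raddfD.
by rewrite string_anticomm ?pauliZX // mul0rn raddf0.
Qed.

Lemma maj_bb (i j : 'I_L) :
  maj_b i *m maj_b j + maj_b j *m maj_b i = - ((i == j)%:R *+ 2)%:M.
Proof.
have [->|ij] := eqVneq i j.
  by rewrite stringM pauliZXZX at_siteN at_site1 mulr2n raddfD opprD.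
by rewrite string_anticomm ?pauliZXX // mul0rn raddf0 oppr0.
Qed.

Lemma maj_ab (i j : 'I_L) : maj_a i *m maj_b j + maj_b j *m maj_a i = 0.
Proof.
have [->|ij] := eqVneq i j; last by rewrite string_anticomm ?pauliZXX ?pauliZX.
rewrite !stringM mulmxA pauliZZ mul1mx pauliZX mulNmx -mulmxA pauliZZ mulmx1.
by rewrite at_siteN addrN.
Qed.

Lemma maj_a_adj j : (maj_a j)^t* = maj_a j.
Proof. by rewrite string_adj pauliZ_adj. Qed.

Lemma maj_b_adj j : (maj_b j)^t* = - maj_b j.
Proof.
rewrite string_adj trmx_mul map_mxM pauliZ_adj pauliX_adj -[RHS]scaleN1r /maj_b /string.
apply: (tensor_mx_scale (j := j)); last by move=> i /negbTE ->.
by rewrite ltnn eqxx pauliZX scaleN1r opprK.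
Qed.

(** This says that c_j annihilates |+...+>: the two strings differ by one X at site j, which fixes
    |+>. *)
Lemma maj_vacuum j : maj_a j *m all_plus R L = maj_b j *m all_plus R L.
Proof.
rewrite !tensor_mxV; apply: eq_tensor_vec => i.
by case: ifP => // _; case: eqP => // _; rewrite -mulmxA pauliX_plus.
Qed.

Lemma X_maj j : X_ R j = - (maj_b j *m maj_a j).
Proof.
by rewrite stringM {1}pauliZX mulNmx -mulmxA pauliZZ mulmx1 at_siteN opprK.
Qed.

Lemma parityE : parity R L = tensor_mx (fun=> sx).
Proof.
rewrite /parity.
have : uniq (index_enum 'I_L) by exact: index_enum_uniq.
have : forall j, j \in index_enum 'I_L by move=> j; exact: mem_index_enum.
move: (index_enum _) => r allr; suff H : uniq r ->
    \prod_(j <- r) X_ R j = tensor_mx (fun i => if i \in r then sx else 1%:M).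
  by move=> /H ->; apply: eq_tensor_mx => i; rewrite allr.
elim: r {allr} => [|j r IH] /=; first by rewrite big_nil tensor_mx1.
move=> /andP[jr /IH E]; rewrite big_cons E -mulmxE tensor_mxM.
apply: eq_tensor_mx => i; rewrite inE; case: eqP => [->|_] /=; last by rewrite mul1mx.
by rewrite (negbTE jr) mulmx1.
Qed.

(** The tails cancel below j, the X that the longer tail leaves at j turns ZX into Z, and Z remains
    at j + 1. *)
Lemma ZZ_maj (j : 'I_L) : (j.+1 < L)%N ->
  Z_ R j *m Z_ R (ordS j) = maj_b j *m maj_a (ordS j).
Proof.
move=> jL; have Sj : ordS j = j.+1 :> nat by rewrite /= modn_small.
rewrite !tensor_mxM; move: (ordS j) Sj => k Sj; apply: eq_tensor_mx => i.
rewrite -[i == k]val_eqE -[i == j]val_eqE /= Sj.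
have [ij|ij|ij] := ltngtP i j.
- by rewrite (leq_trans ij (leqnSn j)) ltn_eqF ?(leq_trans ij) // mul1mx pauliXX.
- by rewrite ltnNge ij /=; case: eqP; rewrite !mul1mx.
- by rewrite ij ltnSn ltn_eqF // mulmx1 -mulmxA pauliXX mulmx1.
Qed.

(** Here the string of [maj_b] runs over the whole chain, and the parity operator removes it. The
    sign is that of XZX = -Z at site 0. *)
Lemma ZZ_maj_last (j : 'I_L) : (1 < L)%N -> j.+1 = L ->
  Z_ R j *m Z_ R (ordS j) = - (maj_b j *m maj_a (ordS j) *m parity R L).
Proof.
move=> L1 jL; have Sj : ordS j = 0%N :> nat by rewrite /= jL modnn.
rewrite parityE !tensor_mxM -[RHS]scaleN1r.
move: (ordS j) Sj => k Sj; apply: (tensor_mx_scale (j := k)).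
  rewrite eqxx -val_eqE /= Sj ltnn -ltnS jL L1.
  have -> : (0%N == j) = false by apply/eqP => j0; move: L1; rewrite -jL -j0.
  by rewrite mul1mx -mulmxA pauliZX mulmxN mulmxA pauliXX mul1mx scaleN1r opprK.
move=> i ik; rewrite Sj (negbTE ik) !mulmx1 -[_ == j]val_eqE /=.
have : (i <= j)%N by rewrite -ltnS jL.
rewrite leq_eqVlt => /predU1P[->|ij]; first by rewrite ltnn eqxx -mulmxA pauliXX mulmx1.
by rewrite ij ltn_eqF // pauliXX.
Qed.

Lemma parityK : parity R L *m parity R L = 1%:M.
Proof. by rewrite parityE tensor_mxM -tensor_mx1; apply: eq_tensor_mx => i; rewrite pauliXX. Qed.

Lemma parity_adj : (parity R L)^t* = parity R L.
Proof. by rewrite parityE tensor_mx_adj; apply: eq_tensor_mx => i; rewrite pauliX_adj. Qed.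

Lemma parity_plus : parity R L *m all_plus R L = all_plus R L.
Proof. by rewrite parityE tensor_mxV; apply: eq_tensor_vec => i; rewrite pauliX_plus. Qed.

Lemma parity_string M j : M *m sx = - (sx *m M) ->
  string M j *m parity R L = - (parity R L *m string M j).
Proof.
move=> MX; rewrite parityE !tensor_mxM -[RHS]scaleN1r; apply: (tensor_mx_scale (j := j)).
  by rewrite ltnn eqxx MX scaleN1r.
by move=> i /negbTE ->; case: ifP; rewrite // mul1mx mulmx1.
Qed.

Lemma plus_norm : (all_plus R L)^t* *m all_plus R L = 1%:M.
Proof.
apply/matrixP => i j; rewrite !ord1 !mxE.
transitivity (\prod_(j < L) (((plus R)^t* *m plus R) 0 0)).
  under [RHS]eq_bigr do rewrite mxE.
  rewrite bigA_distr_bigA -sum_bits.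
  apply: eq_bigr => a _; rewrite !mxE rmorph_prod -big_split.
  by apply: eq_bigr => k _; rewrite !mxE.
by rewrite big1 // => k _; rewrite plus_adj_plus mxE.
Qed.

Lemma mulmx_adj m n p (A : 'M[C]_(m, n)) (B : 'M[C]_(n, p)) :
  (A *m B)^t* = B^t* *m A^t*.
Proof. by rewrite trmx_mul map_mxM. Qed.

Lemma X_adj j : (@X_ R L j)^t* = X_ R j.
Proof. by rewrite at_site_adj pauliX_adj. Qed.

Lemma Z_adj j : (@Z_ R L j)^t* = Z_ R j.
Proof. by rewrite at_site_adj pauliZ_adj. Qed.

Lemma Z_comm i j : @Z_ R L i *m Z_ R j = Z_ R j *m Z_ R i.
Proof.
rewrite !tensor_mxM; apply: eq_tensor_mx => k.
by case: eqP => _; case: eqP => _; rewrite ?mul1mx ?mulmx1.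
Qed.

Lemma sum_adj (I : finType) m n (F : I -> 'M[C]_(m, n)) :
  (\sum_i F i)^t* = \sum_i (F i)^t*.
Proof.
apply/matrixP => a b; rewrite !mxE summxE rmorph_sum summxE.
by apply: eq_bigr => i _; rewrite !mxE.
Qed.

Lemma H1_adj : (H1 R L)^t* = H1 R L.
Proof.
rewrite linearN /= map_mxN sum_adj; congr (- _); apply: eq_bigr => j _.
by rewrite mulmx_adj !Z_adj Z_comm.
Qed.

Lemma H2_adj : (H2 R L)^t* = H2 R L.
Proof.
rewrite linearN /= map_mxN sum_adj; congr (- _); apply: eq_bigr => j _.
exact: X_adj.
Qed.

Lemma HT_adj h : (@HT R L h)^t* = HT L h.
Proof.
rewrite linearD /= map_mxD H1_adj linearZ /= map_mxZ H2_adj.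
by congr (_ + _ *: _); rewrite -[RHS]conjc_real.
Qed.

Lemma Z_parity (j : 'I_L) : Z_ R j *m parity R L = - (parity R L *m Z_ R j).
Proof.
rewrite parityE !tensor_mxM -[RHS]scaleN1r; apply: (tensor_mx_scale (j := j)).
  by rewrite eqxx pauliZX scaleN1r.
by move=> i /negbTE ->; rewrite mul1mx mulmx1.
Qed.

Lemma H1_parity : H1 R L *m parity R L = parity R L *m H1 R L.
Proof.
rewrite mulNmx mulmxN mulmx_suml mulmx_sumr; congr (- _); apply: eq_bigr => j _.
by rewrite -mulmxA Z_parity mulmxN !mulmxA Z_parity mulNmx opprK.
Qed.

Lemma H2_parity : H2 R L *m parity R L = parity R L *m H2 R L.
Proof.
rewrite mulNmx mulmxN mulmx_suml mulmx_sumr; congr (- _); apply: eq_bigr => j _.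
rewrite parityE !tensor_mxM; apply: eq_tensor_mx => i.
by case: eqP => // _; rewrite mul1mx mulmx1.
Qed.

Lemma HT_parity h : @HT R L h *m parity R L = parity R L *m HT L h.
Proof. by rewrite mulmxDl mulmxDr H1_parity -scalemxAl H2_parity scalemxAr. Qed.

End Spins.

(** * States of fermion pairs *)

Section Pairs.
Variables (R : realType) (n K : nat) (I : eqType).
Local Notation C := R[i].
Variables (d ad : I -> 'M[C]_n) (Om : 'cV[C]_n) (u w : 'I_K -> I).
Hypothesis aa : forall i j, ad i *m ad j = - (ad j *m ad i).
Hypothesis da : forall i j, d i *m ad j = (i == j)%:R%:M - ad j *m d i.
Hypothesis dOm : forall i, d i *m Om = 0.
Hypothesis d_adj : forall i, (d i)^t* = ad i.
Hypothesis Om_norm : Om^t* *m Om = 1%:M.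
Hypothesis u_inj : injective u.
Hypothesis w_inj : injective w.
Hypothesis uw : forall k l, u k != w l.

(** These are pseudospin operators: on pair states [pair_num k - 1] takes the values -1 (empty) and
    1 (occupied), and the other two exchange these states. *)
Definition pair_raise k := ad (u k) *m ad (w k).
Definition pair_lower k := d (w k) *m d (u k).
Definition pair_num k := ad (u k) *m d (u k) + ad (w k) *m d (w k).
Local Notation T := pair_raise.
Local Notation T' := pair_lower.
Local Notation N := pair_num.

(** Moving a product of two past a product of two costs four signs, so pairs of fermion operators
    commute like bosons. *)
Lemma anticomm_comm (x y z t : 'M[C]_n) :
    x *m z = - (z *m x) -> x *m t = - (t *m x) ->
    y *m z = - (z *m y) -> y *m t = - (t *m y) ->
  (x *m y) *m (z *m t) = (z *m t) *m (x *m y).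
Proof.
move=> xz xt yz yt; rewrite -mulmxA [y *m _]mulmxA yz mulNmx -[z *m y *m t]mulmxA yt.
by rewrite !mulmxN opprK mulmxA xz mulNmx -[z *m x *m _]mulmxA [x *m (t *m y)]mulmxA xt mulNmx mulmxN opprK !mulmxA.
Qed.

Lemma da_neq i j : i != j -> d i *m ad j = - (ad j *m d i).
Proof. by move=> /negbTE ij; rewrite da ij raddf0 sub0r. Qed.

Lemma pair_comm k l : k != l ->
  [/\ T k *m T l = T l *m T k, T' k *m T l = T l *m T' k & N k *m T l = T l *m N k].
Proof.
move=> kl.
have uu : u k != u l by apply: contra_neq kl => /u_inj.
have ww : w k != w l by apply: contra_neq kl => /w_inj.
have wu : w k != u l by rewrite eq_sym.
have uwkl := uw k l.
by split; rewrite ?mulmxDl ?mulmxDr; [|idtac|congr (_ + _)]; apply: anticomm_comm;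
  by [apply: aa|apply: da_neq].
Qed.

Lemma adad i : ad i *m ad i = 0.
Proof.
have : (ad i *m ad i) *+ 2 = 0 by rewrite mulr2n {1}aa addNr.
by move/eqP; rewrite -scaler_nat scaler_eq0 pnatr_eq0 => /eqP.
Qed.

Lemma raise_raise k : T k *m T k = 0.
Proof.
rewrite /T -mulmxA [ad (w k) *m _]mulmxA [ad (w k) *m _]aa mulNmx.
by rewrite -[ad (u k) *m _ *m _]mulmxA adad !mulmx0 oppr0 mulmx0.
Qed.

Lemma lower_Om k : T' k *m Om = 0.
Proof. by rewrite -mulmxA dOm mulmx0. Qed.

Lemma num_Om k : N k *m Om = 0.
Proof. by rewrite mulmxDl -!mulmxA !dOm !mulmx0 addr0. Qed.

Lemma d_ad_Om i : d i *m (ad i *m Om) = Om.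
Proof. by rewrite mulmxA da eqxx mulmxBl mul1mx -mulmxA dOm mulmx0 subr0. Qed.

Lemma d_ad_neq_Om i j : i != j -> d i *m (ad j *m Om) = 0.
Proof. by move=> ij; rewrite mulmxA da_neq // mulNmx -mulmxA dOm mulmx0 oppr0. Qed.

Lemma d_raise_Om k : d (u k) *m (T k *m Om) = ad (w k) *m Om.
Proof.
rewrite -mulmxA mulmxA da eqxx mulmxBl mul1mx -[_ *m d _ *m _]mulmxA.
by rewrite d_ad_neq_Om // mulmx0 subr0.
Qed.

Lemma lower_raise_Om k : T' k *m (T k *m Om) = Om.
Proof. by rewrite -mulmxA d_raise_Om d_ad_Om. Qed.

Lemma num_raise_Om k : N k *m (T k *m Om) = 2 *: (T k *m Om).
Proof.
rewrite mulmxDl -[X in X + _]mulmxA -[X in _ + X]mulmxA d_raise_Om /T -[ad _ *m ad _ *m _]mulmxA.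
have Tw : ad (u k) *m (ad (w k) *m Om) = - (ad (w k) *m (ad (u k) *m Om)).
  by rewrite !mulmxA aa mulNmx.
rewrite [X in d (w k) *m X]Tw mulmxN [d _ *m _]mulmxA da eqxx mulmxBl mul1mx.
rewrite -[_ *m d _ *m _]mulmxA d_ad_neq_Om 1?eq_sym // mulmx0 subr0 mulmxN -Tw.
by rewrite scaler_nat mulr2n.
Qed.

(** Matrix products are ordered, so isolating a factor in the manner of [bigD1] rests on pairwise
    commutation. *)
Lemma prod_pull (F : 'I_K -> 'M[C]_n) (i : 'I_K) :
    (forall k l, k != l -> F k *m F l = F l *m F k) ->
  \prod_k F k = F i *m \prod_(k | k != i) F k.
Proof.
rewrite mulmxE => Fc.
have : uniq (index_enum 'I_K) by exact: index_enum_uniq.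
have : i \in index_enum 'I_K by exact: mem_index_enum.
elim: (index_enum _) => //= j r IH; rewrite inE => ijr /andP[jr ur].
rewrite !big_cons; have [ij|ij] := eqVneq j i.
  congr (_ * _); first by rewrite ij.
  rewrite [LHS]big_seq [RHS]big_seq_cond; apply: eq_bigl => k.
  by case: (boolP (k \in r)) => // kr; rewrite -ij; apply/esym; apply: contraNneq jr => <-.
move: ijr; rewrite eq_sym (negbTE ij) /= => ir.
by rewrite IH // !mulrA Fc // eq_sym.
Qed.

Definition upd (s : {ffun 'I_K -> 'I_2}) (k : 'I_K) (x : 'I_2) : {ffun 'I_K -> 'I_2} :=
  [ffun l => if l == k then x else s l].

Definition pair_factor (s : {ffun 'I_K -> 'I_2}) k : 'M[C]_n :=
  if s k == 1 then T k else 1%:M.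

Definition pair_state s : 'cV[C]_n := (\prod_k pair_factor s k) *m Om.

Lemma factor_comm s k l : k != l ->
  pair_factor s k *m pair_factor s l = pair_factor s l *m pair_factor s k.
Proof.
move=> kl; rewrite /pair_factor.
by case: ifP; case: ifP; rewrite ?mulmx1 ?mul1mx //; have [] := pair_comm kl.
Qed.

Let rest s k := \prod_(l | l != k) pair_factor s l.

Lemma rest_upd s k x : rest (upd s k x) k = rest s k.
Proof. by apply: eq_bigr => l /negbTE lk; rewrite /pair_factor ffunE lk. Qed.

Lemma pair_stateE s k : pair_state s = pair_factor s k *m (rest s k *m Om).
Proof. by rewrite /pair_state (prod_pull k (@factor_comm s)) mulmxA. Qed.

Lemma rest_comm X s k : (forall l, k != l -> X *m T l = T l *m X) ->
  X *m rest s k = rest s k *m X.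
Proof.
rewrite mulmxE => XT; apply: commr_prod => l lk; rewrite /pair_factor.
by case: ifP => _; [apply: XT; rewrite eq_sym|exact: commr1].
Qed.

Lemma raise_state s k :
  T k *m pair_state s = if s k == 1 then 0 else pair_state (upd s k 1).
Proof.
rewrite !(pair_stateE _ k) rest_upd /pair_factor ffunE !eqxx.
case: ifP => _; last by rewrite mul1mx.
by rewrite mulmxA raise_raise mul0mx.
Qed.

(** Places the factor of slot k next to the vacuum, where lowering and counting can be evaluated
    directly. *)
Lemma pair_state_rest s k :
  pair_state s = rest s k *m (pair_factor s k *m Om).
Proof.
rewrite (pair_stateE _ k) !mulmxA; congr (_ *m _); rewrite /pair_factor.
case: ifP => _; last by rewrite mul1mx mulmx1.
by apply: rest_comm => l /pair_comm[].
Qed.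

Lemma lower_state s k :
  T' k *m pair_state s = if s k == 1 then pair_state (upd s k 0) else 0.
Proof.
rewrite !(pair_state_rest _ k) rest_upd /pair_factor ffunE !eqxx /= mul1mx.
have Tc : T' k *m rest s k = rest s k *m T' k by apply: rest_comm => l /pair_comm[].
rewrite [LHS]mulmxA Tc -[LHS]mulmxA; case: ifP => _; first by rewrite lower_raise_Om.
by rewrite mul1mx lower_Om mulmx0.
Qed.

Lemma num_state s k :
  N k *m pair_state s = (if s k == 1 then 2 else 0) *: pair_state s.
Proof.
rewrite !(pair_state_rest _ k) /pair_factor.
have Tc : N k *m rest s k = rest s k *m N k by apply: rest_comm => l /pair_comm[].
rewrite [LHS]mulmxA Tc -[LHS]mulmxA; case: ifP => _.
  by rewrite num_raise_Om -scalemxAr.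
by rewrite mul1mx num_Om mulmx0 scale0r.
Qed.

Lemma raise_adj k : (T k)^t* = T' k.
Proof.
have ad_adj i : (ad i)^t* = d i by rewrite -d_adj trmxCK.
by rewrite /T mulmx_adj !ad_adj.
Qed.

Lemma upd_id (s : {ffun 'I_K -> 'I_2}) k : upd s k (s k) = s.
Proof. by apply/ffunP => l; rewrite ffunE; case: eqP => // ->. Qed.

Lemma upd_upd (s : {ffun 'I_K -> 'I_2}) k x y : upd (upd s k x) k y = upd s k y.
Proof. by apply/ffunP => l; rewrite !ffunE; case: eqP. Qed.

Lemma pair_state_lower (s : {ffun 'I_K -> 'I_2}) k : s k = 1 ->
  pair_state s = T k *m pair_state (upd s k 0).
Proof.
move=> sk; rewrite raise_state ffunE eqxx /= upd_upd.
by rewrite -sk upd_id.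
Qed.

Lemma pair_state_diff (s t : {ffun 'I_K -> 'I_2}) k : s k = 1 -> t k = 0 ->
  (pair_state s)^t* *m pair_state t = 0.
Proof.
move=> sk tk; rewrite (pair_state_lower sk) mulmx_adj raise_adj -mulmxA.
by rewrite lower_state tk mulmx0.
Qed.

Lemma pair_state_ortho s t :
  (pair_state s)^t* *m pair_state t = (s == t)%:R%:M.
Proof.
have [<-|st] := eqVneq s t; last first.
  have [k skt] : exists k, s k != t k.
    apply/existsP; move: st; apply: contraNT; rewrite negb_exists => /forallP st.
    by apply/eqP/ffunP => i; apply/eqP; rewrite -[_ == _]negbK.
  rewrite raddf0; case: (I2P (s k)) => sk; case: (I2P (t k)) => tk.
  - by rewrite sk tk eqxx in skt.
  - rewrite -[LHS]trmxCK mulmx_adj trmxCK (pair_state_diff tk sk).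
    by rewrite trmx0 map_mx0.
  - exact: pair_state_diff sk tk.
  - by rewrite sk tk eqxx in skt.
(* Induction on the number of occupied pairs: a raising operator moved to the other side of the
   product becomes a lowering operator and removes one pair. With no pair left the norm is that of
   [Om]. *)
have [m] := ubnP #|[pred k | s k == 1]|.
elim: m s => // m IH s sm.
have [k /= /eqP sk|s0] := pickP [pred k | s k == 1]; last first.
  rewrite /pair_state big1 ?mul1mx // => k _; rewrite /pair_factor.
  by have /= -> := s0 k.
rewrite {2}(pair_state_lower sk) -[T k]trmxCK raise_adj mulmxA -mulmx_adj.
rewrite lower_state sk eqxx IH //.
apply: (@leq_trans #|[pred k | s k == 1]|) => //; apply: proper_card.
apply/fintype.properP; split; last by exists k; rewrite inE ?sk // ffunE eqxx.
by apply/fintype.subsetP => l; rewrite !inE ffunE; case: (l == k).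
Qed.

Definition pair_embedding : 'M[C]_(n, qdim K) :=
  \matrix_(i, s) pair_state (bits s) i 0.

Lemma pair_embeddingV (v : 'cV[C]_(qdim K)) :
  pair_embedding *m v = \sum_s v s 0 *: pair_state (bits s).
Proof.
apply/matrixP => i j; rewrite !ord1 mxE summxE; apply: eq_bigr => s _.
by rewrite !mxE mulrC.
Qed.

Lemma pair_embedding_iso : pair_embedding^t* *m pair_embedding = 1%:M.
Proof.
apply/matrixP => s t.
have := pair_state_ortho (bits s) (bits t) => /matrixP/(_ 0 0).
rewrite !mxE eqxx mulr1n (can_eq (@enum_valK _)) => <-.
by apply: eq_bigr => i _; rewrite !mxE.
Qed.

Lemma pair_embedding_vacuum :
  pair_embedding *m tensor_vec (fun=> \col_i (i == 0)%:R) = Om.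
Proof.
rewrite pair_embeddingV.
transitivity (\sum_s (s == [ffun=> 0])%:R *: pair_state s).
  rewrite -sum_bits; apply: eq_bigr => s _; congr (_ *: _).
  by rewrite mxE -prod_delta; apply: eq_bigr => k _; rewrite mxE ffunE.
rewrite (bigD1 [ffun=> 0]) //= eqxx scale1r big1 ?addr0.
  rewrite /pair_state big1 ?mul1mx // => k _.
  by rewrite /pair_factor ffunE.
by move=> s /negbTE ->; rewrite scale0r.
Qed.

Lemma pair_embedding_site (X : 'M[C]_n) (B : 'M[C]_2) (k : 'I_K) :
    (forall s, X *m pair_state s =
      B 0 (s k) *: pair_state (upd s k 0) + B 1 (s k) *: pair_state (upd s k 1)) ->
  X *m pair_embedding = pair_embedding *m at_site B k.
Proof.
move=> XB; apply/matrixP => i b.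
have -> : (X *m pair_embedding) i b = (X *m pair_state (bits b)) i 0.
  by rewrite !mxE; apply: eq_bigr => j _; rewrite mxE.
rewrite XB -(sum_I2 (fun x => B x (bits b k) *: pair_state (upd (bits b) k x))).
rewrite mxE summxE.
transitivity (\sum_(t : {ffun 'I_K -> 'I_2}) pair_state t i 0 *
    \prod_j (if j == k then B else 1%:M) (t j) (bits b j)); last first.
  by rewrite -sum_bits; apply: eq_bigr => c _; rewrite !mxE.
(* The strings t are grouped by their value x at k; the identity factors at the other slots leave
   only [upd (bits b) k x] in each group. *)
rewrite (partition_big (fun t : {ffun 'I_K -> 'I_2} => t k) xpredT) //=.
apply: eq_bigr => x _; rewrite (bigD1 (upd (bits b) k x)) /=; last by rewrite ffunE eqxx.
rewrite [X in _ = _ + X]big1 ?addr0.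
  rewrite (bigD1 k) //= eqxx ffunE eqxx big1 ?mulr1 ?mxE 1?mulrC //.
  by move=> j /negbTE jk; rewrite jk ffunE jk mxE eqxx.
move=> t /andP[/eqP tk tn]; apply/eqP; apply: contraNT tn.
rewrite mulf_eq0 negb_or => /andP[_ /prodf_neq0 H].
apply/eqP/ffunP => j; rewrite ffunE; case: eqP => [->//|/eqP /negbTE jk].
by have := H j isT; rewrite jk mxE pnatr_eq0 eqb0 negbK => /eqP.
Qed.

Lemma pair_embedding_intertwine (al be ga : C) (k : 'I_K) (B : 'M[C]_2) :
    B 0 0 = - al -> B 0 1 = ga -> B 1 0 = be -> B 1 1 = al ->
  (al *: (N k - 1%:M) + be *: T k + ga *: T' k) *m pair_embedding =
  pair_embedding *m at_site B k.
Proof.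
move=> B00 B01 B10 B11; apply: pair_embedding_site => s.
rewrite !mulmxDl -!scalemxAl mulmxDl mulNmx mul1mx num_state raise_state lower_state.
case: (I2P (s k)) (upd_id s k) => -> us; rewrite ?eqxx /= ?B00 ?B01 ?B10 ?B11.
  by rewrite us scale0r sub0r scaler0 addr0 scalerN scaleNr.
by rewrite us scaler0 addr0 scaler_nat mulr2n addrK addrC.
Qed.

End Pairs.

(** * Fourier modes with antiperiodic boundary conditions *)

Section Fourier.
Variables (R : realType) (L : nat).
Hypothesis L_even : ~~ odd L.
Hypothesis L_gt1 : (1 < L)%N.
Local Notation C := R[i].

(** The solutions of e^{iqL} = -1 in (0, 2 pi) for n < L. The indices below L/2 give NS_+, and
    [rev_ord] is q -> -q modulo 2 pi. *)
Definition momentum (n : nat) : R := 2 * pi * (n%:R + 2^-1) / L%:R.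

Lemma L_neq0 : L%:R != 0 :> R.
Proof. by rewrite pnatr_eq0; case: L L_gt1. Qed.

Lemma expiMn (t : R) n : expi (t *+ n) = expi t ^+ n :> C.
Proof.
elim: n => [|n IH]; first by rewrite expi0.
by rewrite mulrS expiD IH exprS.
Qed.

Lemma expi_pi : expi pi = -1 :> C.
Proof. by rewrite /expi cospi sinpi; apply/eqP; rewrite eq_complex /= oppr0 !eqxx. Qed.

Lemma expi_2pi (n : nat) : expi (2 * pi * n%:R) = 1 :> C.
Proof. by rewrite mulr_natr expiMn mulr_natl expiMn expi_pi sqrrN !expr1n. Qed.

Lemma expi_neq1 (t : R) : 0 < t < 2 * pi -> expi t != 1 :> C.
Proof.
move=> /andP[t0 t2]; apply/eqP => /(congr1 (@complex.Re R)) /= ct.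
have : 0 < sin (t / 2).
  apply: sin_gt0_pi; rewrite divr_gt0 //=.
  by rewrite ltr_pdivrMr // mulrC.
have -> : sin (t / 2) = 0; last by rewrite ltxx.
have : cos (t / 2 *+ 2) = 1 by rewrite -mulr_natr divfK ?pnatr_eq0.
rewrite cos_mulr2n cos2sin2 => E; apply/eqP; rewrite -sqrf_eq0; apply/eqP.
lra.
Qed.

Lemma momentum_rev (n : 'I_L) : momentum (rev_ord n) = 2 * pi - momentum n.
Proof.
rewrite /momentum /= natrB // -[n.+1]addn1 natrD.
have := L_neq0; move: (L%:R) => l l0; field; exact: l0.
Qed.

Lemma expi_momentum_rev (n : 'I_L) :
  expi (momentum (rev_ord n)) = expi (- momentum n) :> C.
Proof. by rewrite momentum_rev expiD -[2 * pi]mulr1 (expi_2pi 1) mul1r. Qed.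

Lemma expi_momentumL (n : 'I_L) : expi (momentum n) ^+ L = -1 :> C.
Proof.
rewrite -expiMn -mulr_natr /momentum divfK ?L_neq0 // mulrDr expiD expi_2pi mul1r.
by rewrite mulrAC mulfV ?pnatr_eq0 // mul1r expi_pi.
Qed.

Definition plane_wave (n j : 'I_L) : C :=
  ((Num.sqrt L%:R)^-1)%:C * expi (momentum n) ^+ j.

Lemma plane_wave_rev n j : plane_wave (rev_ord n) j = (plane_wave n j)^*.
Proof.
rewrite rmorphM rmorphXn /= -[X in _ = X * _]/(_ ^*)%C conjc_real.
by rewrite /plane_wave expi_momentum_rev -conj_expi.
Qed.

Lemma sqrtL2 : ((Num.sqrt L%:R)^-1)%:C * ((Num.sqrt L%:R)^-1)%:C * L%:R = 1 :> C.
Proof.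
have -> : L%:R = (L%:R)%:C :> C by rewrite rmorph_nat.
rewrite -!rmorphM /= -invfM -expr2 sqr_sqrtr ?ler0n // mulVf ?L_neq0 //.
Qed.

Lemma geom_expi (m n : 'I_L) :
  \sum_(j < L) (expi (momentum m) * expi (- momentum n) : C) ^+ j = (m == n)%:R * L%:R.
Proof.
have [<-|mn] := eqVneq m n.
  rewrite expiVr mul1r; under eq_bigr do rewrite expr1n.
  by rewrite sumr_const card_ord.
rewrite mul0r; set z := _ * _.
(* Each of the two factors has L-th power -1, so [z] is an L-th root of unity; once it differs from
   1, its geometric sum vanishes. *)
have zL : z ^+ L = 1.
  by rewrite exprMn -conj_expi -rmorphXn !expi_momentumL rmorphN rmorph1 mulrNN mulr1.
have z1 : z != 1.
  (* For b < a the difference of momenta lies strictly between 0 and 2 pi; the opposite order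
     follows by conjugation. *)
  have key (a b : 'I_L) : (b < a)%N -> expi (momentum a - momentum b) != 1 :> C.
    move=> ba; apply: expi_neq1.
    have -> : momentum a - momentum b = 2 * pi * ((a - b)%:R / L%:R).
      rewrite natrB ?(ltnW ba) // /momentum; have := L_neq0.
      by move: (L%:R) => l l0; field; exact: l0.
    have L0 : 0 < L%:R :> R by rewrite lt_neqAle eq_sym L_neq0 ler0n.
    have pp : 0 < 2 * pi :> R by rewrite mulr_gt0 // pi_gt0.
    apply/andP; split; first by apply: mulr_gt0 => //; apply: divr_gt0 => //; rewrite ltr0n subn_gt0.
    rewrite gtr_pMr //.
    by rewrite ltr_pdivrMr // mul1r ltr_nat (leq_ltn_trans (leq_subr _ _)).
  rewrite /z -expiD; have [lt|lt|/val_inj e] := ltngtP m n; last by rewrite e eqxx in mn.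
    apply/eqP => e1; have /negP[] := key _ _ lt; apply/eqP.
    by rewrite -[LHS]conjCK -[LHS]/(((expi _)^*)^*) conj_expi opprB e1 rmorph1.
  exact: key.
have := subrX1 z L; rewrite zL subrr => /esym/eqP.
by rewrite mulf_eq0 subr_eq0 (negbTE z1) => /eqP.
Qed.

Lemma plane_wave_ortho m n :
  \sum_j plane_wave m j * (plane_wave n j)^* = (m == n)%:R.
Proof.
rewrite -[RHS]mulr1 -[X in _ = _ * X]sqrtL2 [RHS]mulrCA -geom_expi mulr_sumr; apply: eq_bigr => j _.
rewrite -plane_wave_rev /plane_wave expi_momentum_rev exprMn; ring.
Qed.

(** The matrix of plane waves is square, so its right inverse, given by orthogonality, is also a
    left inverse. *)
Lemma plane_wave_complete i j :
  \sum_n plane_wave n i * (plane_wave n j)^* = (i == j)%:R.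
Proof.
pose F : 'M[C]_L := \matrix_(n, j) plane_wave n j.
have FF : F *m F^t* = 1%:M.
  apply/matrixP => m n; rewrite !mxE -plane_wave_ortho.
  by apply: eq_bigr => k _; rewrite !mxE.
have /matrixP/(_ j i) := mulmx1C FF; rewrite !mxE eq_sym => <-.
by apply: eq_bigr => n _; rewrite !mxE mulrC.
Qed.

(* On the sector of parity +1 the bond from site L - 1 to site 0 has the opposite
   fermionic sign. *)
Definition wrap_sign (j : 'I_L) : C := if (j.+1 < L)%N then 1 else -1.

Lemma plane_wave_shift (n j : 'I_L) :
  expi (momentum n) * plane_wave n j = wrap_sign j * plane_wave n (ordS j).
Proof.
rewrite /plane_wave mulrCA -exprS [RHS]mulrCA; congr (_ * _); rewrite /wrap_sign.
case: ltnP => jL; first by rewrite /= modn_small // mul1r.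
have -> : j.+1 = L by apply/eqP; rewrite eqn_leq jL ltn_ord.
by rewrite expi_momentumL /= (_ : j.+1 = L) ?modnn ?mulr1 //; apply/eqP; rewrite eqn_leq jL ltn_ord.
Qed.

Section Bilinear.
Variables (m : nat) (U V : 'I_L -> 'M[C]_m).

Lemma mulmx_lincomb (a b : 'I_L -> C) :
  (\sum_j a j *: U j) *m (\sum_k b k *: V k) =
  \sum_j \sum_k (a j * b k) *: (U j *m V k).
Proof.
rewrite mulmx_suml; apply: eq_bigr => j _; rewrite mulmx_sumr; apply: eq_bigr => k _.
by rewrite -scalemxAl -scalemxAr scalerA.
Qed.

(** Turns a sum over momenta into a sum over sites. The weight 1 gives the on-site form of [H2], and
    the weight e^{iq} the nearest-neighbour form of [H1]. *)
Lemma weighted_modes (c : 'I_L -> C) (W : 'I_L -> 'I_L -> C) :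
    (forall j k, \sum_n c n * (plane_wave n j * (plane_wave n k)^*) = W j k) ->
  \sum_n c n *: ((\sum_j plane_wave n j *: U j) *m (\sum_k (plane_wave n k)^* *: V k)) =
  \sum_j \sum_k W j k *: (U j *m V k).
Proof.
move=> cW; under eq_bigr => n _.
  rewrite mulmx_lincomb scaler_sumr; under eq_bigr => j _.
    rewrite scaler_sumr; under eq_bigr => k _ do rewrite scalerA; over.
  over.
rewrite exchange_big; apply: eq_bigr => j _; rewrite exchange_big; apply: eq_bigr => k _.
by rewrite -scaler_suml cW.
Qed.

Lemma anticomm_lincomb (x : C) (a b : 'I_L -> C) :
    (forall j k, U j *m V k + V k *m U j = ((j == k)%:R * x)%:M) ->
  (\sum_j a j *: U j) *m (\sum_k b k *: V k) +
    (\sum_k b k *: V k) *m (\sum_j a j *: U j) = (x * \sum_j a j * b j)%:M.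
Proof.
move=> UV; rewrite mulmx_lincomb.
have -> : (\sum_k b k *: V k) *m (\sum_j a j *: U j) =
    \sum_j \sum_k (a j * b k) *: (V k *m U j).
  rewrite exchange_big mulmx_suml; apply: eq_bigr => k _; rewrite mulmx_sumr.
  by apply: eq_bigr => j _; rewrite -scalemxAl -scalemxAr scalerA mulrC.
rewrite -big_split mulr_sumr raddf_sum; apply: eq_bigr => j _.
rewrite -big_split (bigD1 j) //= -scalerDr UV eqxx mul1r scale_scalar_mx mulrC.
rewrite big1 ?addr0 // => k /negbTE kj.
by rewrite -scalerDr UV eq_sym kj mul0r raddf0 scaler0.
Qed.

End Bilinear.

(** [mode_a] and [mode_b] carry opposite conjugations so that [mode_b n *m mode_a n] conserves
    momentum and [weighted_modes] applies to it. *)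
Definition mode_a n := \sum_j (plane_wave n j)^* *: maj_a R j.
Definition mode_b n := \sum_j plane_wave n j *: maj_b R j.

Lemma plane_wave_pair m n : \sum_j plane_wave m j * plane_wave n j = (m == rev_ord n)%:R.
Proof.
rewrite -plane_wave_ortho; apply: eq_bigr => j _.
by rewrite -plane_wave_rev rev_ordK.
Qed.

Lemma rev_eq (m n : 'I_L) : (rev_ord m == n) = (m == rev_ord n).
Proof. by rewrite -(inj_eq rev_ord_inj) rev_ordK. Qed.

Lemma mode_aa m n :
  mode_a m *m mode_a n + mode_a n *m mode_a m = ((m == rev_ord n)%:R *+ 2)%:M.
Proof.
rewrite (@anticomm_lincomb _ _ _ 2); last by move=> j k; rewrite maj_aa mulr_natr.
under eq_bigr do rewrite -!plane_wave_rev.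
by rewrite plane_wave_pair rev_ordK rev_eq mulr_natl.
Qed.

Lemma mode_bb m n :
  mode_b m *m mode_b n + mode_b n *m mode_b m = - ((m == rev_ord n)%:R *+ 2)%:M.
Proof.
rewrite (@anticomm_lincomb _ _ _ (-2)); last first.
  by move=> j k; rewrite maj_bb mulrN mulr_natr raddfN.
by rewrite plane_wave_pair mulNr mulr_natl raddfN.
Qed.

Lemma mode_ab m n : mode_a m *m mode_b n + mode_b n *m mode_a m = 0.
Proof.
rewrite (@anticomm_lincomb _ _ _ 0); last by move=> j k; rewrite maj_ab mulr0 raddf0.
by rewrite mul0r raddf0.
Qed.

Lemma mode_a_adj n : (mode_a n)^t* = mode_a (rev_ord n).
Proof.
rewrite sum_adj; apply: eq_bigr => j _.
by rewrite linearZ /= map_mxZ plane_wave_rev maj_a_adj.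
Qed.

Lemma mode_b_adj n : (mode_b n)^t* = - mode_b (rev_ord n).
Proof.
rewrite sum_adj -sumrN; apply: eq_bigr => j _.
by rewrite linearZ /= map_mxZ plane_wave_rev maj_b_adj scalerN.
Qed.

Fact ann_key : unit. Proof. by []. Qed.
Fact cre_key : unit. Proof. by []. Qed.
(* Locked: otherwise unification keeps comparing annihilators with creators by unfolding them. *)
Definition ann n := locked_with ann_key (2^-1 *: (mode_a n - mode_b (rev_ord n))).
Definition cre n := locked_with cre_key (2^-1 *: (mode_a (rev_ord n) + mode_b n)).

Lemma annE n : ann n = 2^-1 *: (mode_a n - mode_b (rev_ord n)).
Proof. by rewrite /ann unlock. Qed.

Lemma creE n : cre n = 2^-1 *: (mode_a (rev_ord n) + mode_b n).
Proof. by rewrite /cre unlock. Qed.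

Lemma ann_adj n : (ann n)^t* = cre n.
Proof.
rewrite annE creE linearZ /= map_mxZ linearB /= map_mxB mode_a_adj mode_b_adj rev_ordK opprK.
by rewrite fmorphV rmorph_nat.
Qed.

Local Notation ac A B := (A *m B + B *m A).

Lemma acDl m (A B D : 'M[C]_m) : ac (A + B) D = ac A D + ac B D.
Proof. by rewrite mulmxDl mulmxDr addrACA. Qed.

Lemma acDr m (A B D : 'M[C]_m) : ac D (A + B) = ac D A + ac D B.
Proof. by rewrite mulmxDl mulmxDr addrACA. Qed.

Lemma acNl m (A B : 'M[C]_m) : ac (- A) B = - ac A B.
Proof. by rewrite mulNmx mulmxN opprD. Qed.

Lemma acNr m (A B : 'M[C]_m) : ac A (- B) = - ac A B.
Proof. by rewrite mulNmx mulmxN opprD. Qed.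

Lemma acZ m (c e : C) (A B : 'M[C]_m) : ac (c *: A) (e *: B) = (c * e) *: ac A B.
Proof. by rewrite -!scalemxAl -!scalemxAr !scalerA [e * c]mulrC scalerDr. Qed.

Lemma mode_ba m n : mode_b m *m mode_a n + mode_a n *m mode_b m = 0.
Proof. by rewrite addrC mode_ab. Qed.

(** The anticommutators of [mode_a] and of [mode_b] have opposite signs: their contributions cancel
    here and in [cre_cre], and add up in [ann_cre]. *)
Lemma ann_ann m n : ann m *m ann n = - (ann n *m ann m).
Proof.
apply/eqP; rewrite -addr_eq0; apply/eqP.
rewrite ?annE ?creE acZ acDl !acDr !acNl !acNr mode_aa mode_bb mode_ab mode_ba.
by rewrite oppr0 addr0 add0r opprK rev_ordK rev_eq subrr scaler0.
Qed.

Lemma cre_cre m n : cre m *m cre n = - (cre n *m cre m).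
Proof.
apply/eqP; rewrite -addr_eq0; apply/eqP.
rewrite ?annE ?creE acZ acDl !acDr mode_aa mode_bb mode_ab mode_ba.
by rewrite addr0 add0r rev_ordK rev_eq subrr scaler0.
Qed.

Lemma ann_cre m n : ann m *m cre n = (m == n)%:R%:M - cre n *m ann m.
Proof.
apply/eqP; rewrite eq_sym subr_eq eq_sym; apply/eqP.
rewrite ?annE ?creE acZ acDl !acDr !acNl mode_aa mode_bb mode_ab mode_ba.
rewrite oppr0 addr0 add0r opprK rev_ordK (inj_eq rev_ord_inj).
rewrite -raddfD /= scale_scalar_mx; congr (_%:M).
by rewrite -mulr2n -mulr_natr -[_ *+ 2]mulr_natr -!mulrA mulrCA; field.
Qed.

Lemma ann_plus n : ann n *m all_plus R L = 0.
Proof.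
rewrite annE -scalemxAl mulmxBl /mode_a /mode_b !mulmx_suml.
rewrite -sumrB big1 ?scaler0 // => j _.
by rewrite plane_wave_rev -!scalemxAl maj_vacuum subrr.
Qed.

Lemma halves m (A : 'M[C]_m) : 2^-1 *: (A + A) = A.
Proof. by rewrite -mulr2n -[A *+ 2]scaler_nat scalerA mulVf ?scale1r // pnatr_eq0. Qed.

Lemma mode_aE n : mode_a n = ann n + cre (rev_ord n).
Proof. by rewrite annE creE rev_ordK -scalerDr [mode_a n + mode_b _]addrC addrA subrK halves. Qed.

Lemma mode_bE n : mode_b n = cre n - ann (rev_ord n).
Proof.
by rewrite annE creE rev_ordK -scalerBr opprB addrC addrA subrK halves.
Qed.

Lemma half_leq : (L./2 <= L)%N.
Proof. by rewrite -{2}(even_halfK L_even) -addnn leq_addr. Qed.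

Definition pos_mode (k : 'I_L./2) : 'I_L := widen_ord half_leq k.
Definition neg_mode (k : 'I_L./2) : 'I_L := rev_ord (pos_mode k).

Lemma pos_mode_inj : injective pos_mode.
Proof. by move=> k l /(congr1 val) /= /val_inj. Qed.

Lemma neg_mode_inj : injective neg_mode.
Proof. by move=> k l /rev_ord_inj/pos_mode_inj. Qed.

Lemma pos_neg_mode k l : pos_mode k != neg_mode l.
Proof.
rewrite -val_eqE /=; have := ltn_ord k; have := ltn_ord l; have := even_halfK L_even.
by rewrite -addnn; lia.
Qed.

Lemma sum_modes (V : nmodType) (F : 'I_L -> V) :
  \sum_n F n = \sum_k (F (pos_mode k) + F (neg_mode k)).
Proof.
have E := even_halfK L_even; rewrite -addnn in E.
rewrite (bigID (fun n : 'I_L => (n < L./2)%N)) /= big_split; congr (_ + _).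
  by rewrite (big_ord_narrow half_leq).
rewrite (reindex_inj rev_ord_inj) /=.
rewrite (eq_bigl (fun n : 'I_L => (n < L./2)%N)); last first.
  by move=> n /=; have nL := ltn_ord n; apply/idP/idP; lia.
by rewrite (big_ord_narrow half_leq).
Qed.

Local Notation T := (pair_raise cre pos_mode neg_mode).
Local Notation T' := (pair_lower ann pos_mode neg_mode).
Local Notation N := (pair_num ann cre pos_mode neg_mode).
Local Notation M n := (mode_b n *m mode_a n).

(** Here p and q stand for the annihilators at momenta k and -k, and the primed letters for their
    creators. *)
Lemma pair_product m (p q p' q' : 'M[C]_m) : q *m q' = 1%:M - q' *m q ->
  (p' - q) *m (p + q') = (p' *m p + q' *m q - 1%:M) + (p' *m q' - q *m p).
Proof.
move=> qq; rewrite mulmxBl !mulmxDr qq.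
move: (p' *m p) (q' *m q) (p' *m q') (q *m p) => x y z t.
by apply/matrixP => i j; rewrite !mxE; ring.
Qed.

Lemma pair_product_swap m (p q p' q' : 'M[C]_m) :
    p *m p' = 1%:M - p' *m p -> q' *m p' = - (p' *m q') -> p *m q = - (q *m p) ->
  (q' - p) *m (q + p') = (p' *m p + q' *m q - 1%:M) - (p' *m q' - q *m p).
Proof.
move=> pp qp pq; rewrite pair_product // qp pq.
move: (p' *m p) (q' *m q) (p' *m q') (q *m p) => x y z t.
by apply/matrixP => i j; rewrite !mxE; ring.
Qed.

(** The momenta k and -k share the number term and have opposite pair terms. Equal weights thus
    leave only the number term, while the weights e^{iq} and e^{-iq} leave a cosine on it and a sine
    on the pair term. *)
Lemma M_pos k : M (pos_mode k) = (N k - 1%:M) + (T k - T' k).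
Proof.
rewrite mode_bE mode_aE; apply: pair_product.
by rewrite ann_cre eqxx.
Qed.

Lemma M_neg k : M (neg_mode k) = (N k - 1%:M) - (T k - T' k).
Proof.
rewrite mode_bE mode_aE {2 4}/neg_mode rev_ordK.
apply: (pair_product_swap _ (cre_cre _ _) (ann_ann _ _)).
by rewrite ann_cre eqxx.
Qed.

Lemma H2_modes : H2 R L = \sum_k 2 *: (N k - 1%:M).
Proof.
transitivity (\sum_n M n).
  rewrite -(eq_bigr _ (fun n _ => scale1r (M n))) (@weighted_modes _ _ _ _ (fun j k => (j == k)%:R)); last first.
    by move=> j k; rewrite -plane_wave_complete; apply: eq_bigr => n _; rewrite mul1r.
  rewrite /H2 -sumrN; apply: eq_bigr => j _; rewrite X_maj opprK (bigD1 j) //= eqxx scale1r.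
  by rewrite big1 ?addr0 // => k /negbTE kj; rewrite eq_sym kj scale0r.
rewrite sum_modes; apply: eq_bigr => k _.
rewrite (M_neg k) (M_pos k); move: (N k) (T k) (T' k) => A B D.
by apply/matrixP => i j; rewrite !mxE; ring.
Qed.

(* Agrees with [H1] only on the sector of parity +1. *)
Definition H1_fermionic : 'M[C]_(qdim L) := - \sum_(n < L) expi (momentum n) *: M n.

Lemma H1_fermionicE : H1_fermionic =
  - \sum_j wrap_sign j *: (maj_b R j *m maj_a R (ordS j)).
Proof.
rewrite /H1_fermionic (@weighted_modes _ _ _ _ (fun j k => wrap_sign j * (ordS j == k)%:R)).
  congr (- _); apply: eq_bigr => j _; rewrite (bigD1 (ordS j)) //= eqxx mulr1.
  by rewrite big1 ?addr0 // => k /negbTE kj; rewrite eq_sym kj mulr0 scale0r.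
move=> j k; rewrite -plane_wave_complete mulr_sumr; apply: eq_bigr => n _.
by rewrite mulrA plane_wave_shift mulrA.
Qed.

(** Only the wrapping bond contains the parity operator; replacing it by 1 leaves the sign recorded
    in [wrap_sign]. *)
Lemma H1_even_sector (m : nat) (V : 'M[C]_(qdim L, m)) :
  parity R L *m V = V -> H1 R L *m V = H1_fermionic *m V.
Proof.
move=> PV; rewrite H1_fermionicE !mulNmx !mulmx_suml; congr (- _).
apply: eq_bigr => j _; rewrite /wrap_sign; case: ltnP => jL.
  by rewrite ZZ_maj // scale1r.
rewrite ZZ_maj_last //; last by apply/eqP; rewrite eqn_leq jL ltn_ord.
by rewrite mulNmx -[_ *m parity R L *m V]mulmxA PV scaleN1r mulNmx.
Qed.

Lemma H1_modes : H1_fermionic =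
  \sum_(k < L./2) ((- 2 * (cos (momentum k))%:C) *: (N k - 1%:M)
     + (- 2 * 'i * (sin (momentum k))%:C) *: T k
     + (2 * 'i * (sin (momentum k))%:C) *: T' k).
Proof.
rewrite /H1_fermionic sum_modes -sumrN; apply: eq_bigr => k _.
have -> : expi (momentum (neg_mode k)) = (cos (momentum k))%:C - 'i * (sin (momentum k))%:C :> C.
  by rewrite expi_momentum_rev /expi cosN sinN -complexiE; simpc.
have -> : expi (momentum (pos_mode k)) = (cos (momentum k))%:C + 'i * (sin (momentum k))%:C :> C.
  by rewrite /expi -complexiE; simpc.
rewrite (M_neg k) (M_pos k); move: (N k) (T k) (T' k) (cos _)%:C (sin _)%:C => A B D c s.
by apply/matrixP => i j; rewrite !mxE; ring.
Qed.

Definition sector_embedding : 'M[C]_(qdim L, qdim L./2) :=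
  pair_embedding cre (all_plus R L) pos_mode neg_mode.
Local Notation Phi := sector_embedding.

Lemma sector_embedding_iso : Phi^t* *m Phi = 1%:M.
Proof.
apply: (pair_embedding_iso (d := ann)).
- exact: cre_cre.
- exact: ann_cre.
- exact: ann_plus.
- exact: ann_adj.
- exact: plus_norm.
- exact: pos_mode_inj.
- exact: neg_mode_inj.
- exact: pos_neg_mode.
Qed.

Lemma sector_embedding_vacuum :
  Phi *m tensor_vec (fun=> \col_i (i == 0)%:R) = all_plus R L.
Proof. exact: pair_embedding_vacuum. Qed.

Lemma sector_intertwine (al be ga : C) (k : 'I_L./2) (B : 'M[C]_2) :
    B 0 0 = - al -> B 0 1 = ga -> B 1 0 = be -> B 1 1 = al ->
  (al *: (N k - 1%:M) + be *: T k + ga *: T' k) *m Phi = Phi *m at_site B k.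
Proof.
apply: pair_embedding_intertwine.
- exact: cre_cre.
- exact: ann_cre.
- exact: ann_plus.
- exact: pos_mode_inj.
- exact: neg_mode_inj.
- exact: pos_neg_mode.
Qed.

Lemma mode_parity (A : 'M[C]_(qdim L)) n :
  A = ann n \/ A = cre n -> A *m parity R L = - (parity R L *m A).
Proof.
have Pa j : maj_a R j *m parity R L = - (parity R L *m maj_a R j).
  by apply: parity_string; rewrite pauliZX.
have Pb j : maj_b R j *m parity R L = - (parity R L *m maj_b R j).
  by apply: parity_string; rewrite pauliZXX.
have PA k : mode_a k *m parity R L = - (parity R L *m mode_a k).
  rewrite mulmx_suml mulmx_sumr -sumrN; apply: eq_bigr => j _.
  by rewrite -scalemxAl Pa -scalemxAr scalerN.
have PB k : mode_b k *m parity R L = - (parity R L *m mode_b k).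
  rewrite mulmx_suml mulmx_sumr -sumrN; apply: eq_bigr => j _.
  by rewrite -scalemxAl Pb -scalemxAr scalerN.
case=> ->; rewrite ?annE ?creE -scalemxAl -scalemxAr -scalerN; congr (_ *: _).
  by rewrite mulmxBl mulmxBr PA PB opprB opprK addrC.
by rewrite mulmxDl mulmxDr PA PB opprD.
Qed.

Lemma product_parity m (A B P : 'M[C]_m) :
  A *m P = - (P *m A) -> B *m P = - (P *m B) -> P *m (A *m B) = A *m B *m P.
Proof. by move=> AP BP; rewrite -mulmxA BP mulmxN [A *m (P *m B)]mulmxA AP mulNmx opprK mulmxA. Qed.

Lemma sector_embedding_parity : parity R L *m Phi = Phi.
Proof.
apply/matrixP => i s; rewrite [RHS]mxE [LHS]mxE.
suff /matrixP/(_ i 0) : parity R L *m pair_state cre (all_plus R L) pos_mode neg_mode (bits s)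
    = pair_state cre (all_plus R L) pos_mode neg_mode (bits s).
  by rewrite mxE => <-; apply: eq_bigr => j _; rewrite mxE.
rewrite /pair_state mulmxA; set Q := \prod_k _.
have -> : parity R L *m Q = Q *m parity R L.
  rewrite mulmxE; apply: commr_prod => k _; rewrite /pair_factor.
  case: ifP => _; last exact: commr1.
  rewrite /GRing.comm -mulmxE /pair_raise.
  have E n : cre n *m parity R L = - (parity R L *m cre n) by apply: mode_parity; right.
  exact: (product_parity (E _) (E _)).
by rewrite -mulmxA parity_plus.
Qed.

End Fourier.

(** * Dynamics of a single pair *)

Section PairDynamics.
Variable R : realType.
Local Notation C := R[i].

(** This is e^{iaX}. *)
Definition rot (a : R) : 'M[C]_2 :=
  \matrix_(x, y) if x == y then (cos a)%:C else 'i * (sin a)%:C.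

(** Index 0 is the lower level when E > 0, so that the ground vector of such a block is [e0]
    rotated. *)
Definition level (E : R) (x : 'I_2) : R := if x == 0 then - E else E.

(** This is -E (cos(2a) Z + sin(2a) Y), the conjugate of -E Z by e^{iaX}. *)
Definition pair_ham (E a : R) : 'M[C]_2 :=
  \matrix_(x, y) if x == y then (level (E * cos (a *+ 2)) x)%:C
                 else - ('i * (level (E * sin (a *+ 2)) x)%:C).

Definition e0 : 'cV[C]_2 := \col_i (i == 0)%:R.

Lemma ii : ('i : C) * 'i = -1.
Proof. by rewrite -expr2 sqrCi. Qed.

Lemma rotD a b : rot a *m rot b = rot (a + b).
Proof.
have D1 : (cos (a + b))%:C = (cos a)%:C * (cos b)%:C + ('i * (sin a)%:C) * ('i * (sin b)%:C) :> C.
  by rewrite mulrACA ii cosD rmorphB !rmorphM /= mulN1r.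
have D2 : 'i * (sin (a + b))%:C = (cos a)%:C * ('i * (sin b)%:C) + ('i * (sin a)%:C) * (cos b)%:C :> C.
  by rewrite sinD rmorphD !rmorphM /=; ring.
by apply: mx2P => y; case: (I2P y) => ->; rewrite !mxE sum_I2 !mxE /= ?D1 ?D2; ring.
Qed.

Lemma rot0 : rot 0 = 1%:M.
Proof.
by apply: mx2P => y; case: (I2P y) => ->; rewrite !mxE /= ?cos0 ?sin0 ?mulr0.
Qed.

Lemma rotK a : rot a *m rot (- a) = 1%:M.
Proof. by rewrite rotD subrr rot0. Qed.

Lemma rotNK a : rot (- a) *m rot a = 1%:M.
Proof. by rewrite rotD addNr rot0. Qed.

Lemma conj_realC (x : R) : (x%:C)^* = x%:C :> C.
Proof. by rewrite -[RHS]conjc_real. Qed.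

Lemma rot_adj a : (rot a)^t* = rot (- a).
Proof.
by apply: mx2P => y; case: (I2P y) => ->; rewrite !mxE /= ?cosN ?sinN ?rmorphM /=
  ?conj_realC ?conjCi ?rmorphN ?mulrN ?mulNr.
Qed.

Lemma pair_ham_rot E a :
  pair_ham E a *m rot a = rot a *m diag_mx (\row_x (level E x)%:C).
Proof.
have c2 : (cos (a *+ 2))%:C * (cos a)%:C + (sin (a *+ 2))%:C * (sin a)%:C = (cos a)%:C :> C.
  by rewrite -!rmorphM -rmorphD /= -cosB mulr2n addrK.
have s2 : (sin (a *+ 2))%:C * (cos a)%:C - (cos (a *+ 2))%:C * (sin a)%:C = (sin a)%:C :> C.
  by rewrite -!rmorphM -rmorphB /= -sinB mulr2n addrK.
have i2 (x y : C) : - ('i * x) * ('i * y) = x * y.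
  by rewrite mulNr mulrACA ii mulN1r opprK.
apply: mx2P => y; case: (I2P y) => ->; rewrite mul_mx_diag !mxE sum_I2 !mxE /level /=;
  rewrite ?rmorphN !rmorphM /= ?i2.
- by rewrite -[in RHS]c2; ring.
- by rewrite -[in RHS]s2; ring.
- by rewrite -[in RHS]s2; ring.
- by rewrite -[in RHS]c2; ring.
Qed.

(** The closed form of exp(-i t [pair_ham E a]). *)
Definition evo (E a t : R) : 'M[C]_2 :=
  rot a *m diag_mx (\row_x expi (- (t * level E x))) *m rot (- a).

Lemma evo_unitary E a t : (evo E a t)^t* *m evo E a t = 1%:M.
Proof.
rewrite /evo !mulmx_adj !rot_adj opprK -!mulmxA [rot (- a) *m (rot a *m _)]mulmxA rotNK mul1mx.
rewrite [_^t* *m (_ *m _)]mulmxA.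
have -> : (diag_mx (\row_x expi (- (t * level E x)) : 'rV[C]_2))^t* *m
    diag_mx (\row_x expi (- (t * level E x))) = 1%:M.
  rewrite tr_diag_mx map_diag_mx mulmx_diag -diag_const_mx; congr diag_mx.
  apply/rowP => x; rewrite !mxE.
  by rewrite -[X in X * _]/((expi _)^*) conj_expi mulrC expiVr.
by rewrite mul1mx rotK.
Qed.

Lemma evo_isometry E a t (v : 'cV[C]_2) :
  (evo E a t *m v)^t* *m (evo E a t *m v) = v^t* *m v.
Proof. by rewrite mulmx_adj -mulmxA [_^t* *m (_ *m v)]mulmxA evo_unitary mul1mx. Qed.

Section Tensor.
Variable K : nat.
Variables E a : 'I_K -> R.

Definition total_level (s : {ffun 'I_K -> 'I_2}) : R := \sum_k level (E k) (s k).

Lemma tensor_diag (d : 'I_K -> 'I_2 -> C) :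
  tensor_mx (fun k => diag_mx (\row_x d k x)) =
  diag_mx (\row_s \prod_k d k (bits s k)).
Proof.
apply/matrixP => s t; rewrite !mxE -mulr_natr -(can_eq (@enum_valK _) s t).
rewrite -[X in _ * X]prod_delta -big_split; apply: eq_bigr => k _.
by rewrite !mxE /= mulr_natr.
Qed.

Lemma at_site_diag (d : 'I_2 -> C) (k : 'I_K) :
  at_site (diag_mx (\row_x d x)) k = diag_mx (\row_s d (bits s k)).
Proof.
transitivity (tensor_mx (fun j => diag_mx (\row_x (if j == k then d x else 1)))).
  apply: eq_tensor_mx => j; case: eqP => // _.
  by rewrite -diag_const_mx; congr diag_mx; apply/rowP => x; rewrite !mxE.
rewrite tensor_diag; congr diag_mx; apply/rowP => s; rewrite !mxE.
by rewrite (bigD1 k) //= eqxx big1 ?mulr1 // => j /negbTE ->.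
Qed.

Definition total_ham : 'M[C]_(qdim K) := \sum_k at_site (pair_ham (E k) (a k)) k.
Definition total_rot : 'M[C]_(qdim K) := tensor_mx (fun k => rot (a k)).

Lemma total_ham_rot :
  total_ham *m total_rot = total_rot *m diag_mx (\row_s (total_level (bits s))%:C).
Proof.
have -> : diag_mx (\row_s (total_level (bits s))%:C) =
    \sum_k at_site (diag_mx (\row_x (level (E k) x)%:C)) k.
  under eq_bigr do rewrite at_site_diag.
  rewrite -raddf_sum; congr diag_mx; apply/rowP => s; rewrite mxE summxE rmorph_sum.
  by apply: eq_bigr => k _; rewrite mxE.
rewrite mulmx_suml mulmx_sumr; apply: eq_bigr => k _; rewrite !tensor_mxM.
apply: eq_tensor_mx => j; case: eqP => [->|_]; first exact: pair_ham_rot.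
by rewrite mul1mx mulmx1.
Qed.

Lemma total_rot_adj : total_rot^t* = tensor_mx (fun k => rot (- a k)).
Proof. by rewrite tensor_mx_adj; apply: eq_tensor_mx => k; rewrite rot_adj. Qed.

Lemma total_rotK : total_rot *m total_rot^t* = 1%:M.
Proof. by rewrite total_rot_adj tensor_mxM -tensor_mx1; apply: eq_tensor_mx => k; rewrite rotK. Qed.

(** The columns of [Phi *m total_rot] are eigenvectors of [A], so [expmx_eigenvector] turns the
    exponential of the large matrix into phases, column by column. *)
Lemma evolution n (A : 'M[C]_n) (Phi : 'M[C]_(n, qdim K)) (t : R) :
    A^t* = A -> A *m Phi = Phi *m total_ham ->
  expmx ((- 'i * t%:C) *: A) *m Phi = Phi *m tensor_mx (fun k => evo (E k) (a k) t).
Proof.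
move=> hA AP.
have -> : tensor_mx (fun k => evo (E k) (a k) t) =
    total_rot *m diag_mx (\row_s expi (- (t * total_level (bits s)))) *m total_rot^t*.
  have -> : diag_mx (\row_s expi (- (t * total_level (bits s)))) =
      tensor_mx (fun k => diag_mx (\row_x expi (- (t * level (E k) x)))).
    rewrite tensor_diag; congr diag_mx; apply/rowP => s; rewrite !mxE.
    by rewrite mulr_sumr -sumrN expi_sum.
  by rewrite total_rot_adj !tensor_mxM.
rewrite !mulmxA; set W := Phi *m total_rot.
have AW : A *m W = W *m diag_mx (\row_s (total_level (bits s))%:C).
  by rewrite mulmxA AP -!mulmxA total_ham_rot.
suff EW : expmx ((- 'i * t%:C) *: A) *m W =
    W *m diag_mx (\row_s expi (- (t * total_level (bits s)))).
  by rewrite -EW /W -!mulmxA total_rotK mulmx1.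
apply/matrixP => i s.
have colE (B : 'M[C]_(n, qdim K)) (X : 'M[C]_n) : (X *m B) i s = (X *m col s B) i 0.
  by rewrite !mxE; apply: eq_bigr => j _; rewrite mxE.
rewrite colE (@expmx_eigenvector _ _ _ _ (total_level (bits s)) t hA).
  by rewrite mul_mx_diag !mxE mulrC.
apply/matrixP => j l; rewrite !ord1.
have -> : (A *m col s W) j 0 = (A *m W) j s.
  by rewrite !mxE; apply: eq_bigr => m _; rewrite mxE.
by rewrite AW mul_mx_diag !mxE mulrC.
Qed.

Lemma evolution_tensor n (A : 'M[C]_n) (Phi : 'M[C]_(n, qdim K)) (t : R) (v : 'I_K -> 'cV[C]_2) :
    A^t* = A -> A *m Phi = Phi *m total_ham ->
  expmx ((- 'i * t%:C) *: A) *m (Phi *m tensor_vec v) =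
  Phi *m tensor_vec (fun k => evo (E k) (a k) t *m v k).
Proof.
by move=> hA AP; rewrite mulmxA (evolution _ hA AP) -mulmxA tensor_mxV.
Qed.

End Tensor.
End PairDynamics.

(** * The 2 x 2 blocks of H1, H2 and H_T(h) *)

Section Sector.
Variables (R : realType) (L : nat).
Hypothesis L_even : ~~ odd L.
Hypothesis L_gt1 : (1 < L)%N.
Local Notation C := R[i].
Local Notation Phi := (sector_embedding R L_even).
Local Notation q k := (momentum R L k).

Lemma momentum_bounds (k : 'I_L./2) : 0 < q k < pi.
Proof.
have L0 : 0 < L%:R :> R by rewrite ltr0n; case: L L_gt1.
have k2 : (k%:R + 2^-1) * 2 < L%:R :> R.
  have : ((k.*2.+1)%:R < L%:R :> R).
    by rewrite ltr_nat; have := ltn_ord k; have := even_halfK L_even; lia.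
  by rewrite -muln2 -addn1 natrD natrM mulrDl mulVf ?pnatr_eq0.
have k0 : 0 < k%:R + 2^-1 :> R by rewrite ltr_wpDl // invr_gt0.
have p0 := pi_gt0 R.
apply/andP; split; first by rewrite !mulr_gt0 // invr_gt0.
rewrite /momentum ltr_pdivrMr //; nra.
Qed.

Lemma sin_momentum_gt0 (k : 'I_L./2) : 0 < sin (q k).
Proof. exact: sin_gt0_pi (momentum_bounds k). Qed.

(** The block of H_T(h) is the plane vector 2 (h - cos q, sin q), with polar angle [ground_angle]
    doubled. Measuring it from the vertical axis avoids a case split, since sin q > 0, and yields
    the first arctangent of K_{h0}. *)
Definition gap_angle (h : R) (k : 'I_L./2) : R := atan ((h - cos (q k)) / sin (q k)).
Definition ground_angle h (k : 'I_L./2) : R := pi / 4 - gap_angle h k / 2.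
(* Equal to sqrt ((h - cos q)^2 + (sin q)^2), since tan (gap_angle) = (h - cos q) / sin q. *)
Definition energy h (k : 'I_L./2) : R := sin (q k) / cos (gap_angle h k).
(** Half of the polar angle pi - q of (-cos q, sin q), the direction at h = 0. *)
Definition ising_angle (k : 'I_L./2) : R := pi / 2 - q k / 2.

Lemma cos_gap_gt0 h k : 0 < cos (gap_angle h k).
Proof. by apply: cos_gt0_pihalf; rewrite atan_gtNpi2 atan_ltpi2. Qed.

Lemma energy_gt0 h k : 0 < energy h k.
Proof. by rewrite divr_gt0 ?sin_momentum_gt0 ?cos_gap_gt0. Qed.

Lemma ground_angle2 h k : ground_angle h k *+ 2 = pi / 2 - gap_angle h k.
Proof. by rewrite /ground_angle -mulr_natr; field. Qed.

Lemma energy_cos h k : energy h k * cos (ground_angle h k *+ 2) = h - cos (q k).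
Proof.
rewrite ground_angle2 cosB cos_pihalf sin_pihalf mul0r add0r mul1r.
rewrite /energy mulrAC -mulrA -/(tan _) atanK mulrC divfK //.
by rewrite gt_eqF // sin_momentum_gt0.
Qed.

Lemma energy_sin h k : energy h k * sin (ground_angle h k *+ 2) = sin (q k).
Proof.
rewrite ground_angle2 sinB cos_pihalf sin_pihalf mul0r subr0 mul1r.
by rewrite /energy divfK // gt_eqF // cos_gap_gt0.
Qed.

Lemma H2_sector : H2 R L *m Phi = Phi *m total_ham (fun=> 2) (fun=> 0).
Proof.
rewrite (H2_modes R L_even L_gt1) mulmx_suml mulmx_sumr; apply: eq_bigr => k _.
rewrite -(sector_intertwine L_even L_gt1 (al := 2) (be := 0) (ga := 0) k).
- by rewrite !scale0r !addr0.
- by rewrite mxE /= /level /= mul0rn cos0 mulr1 rmorphN rmorph_nat.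
- by rewrite mxE /= /level /= mul0rn sin0 mulr0 oppr0 mulr0 oppr0.
- by rewrite mxE /= /level /= mul0rn sin0 mulr0 mulr0 oppr0.
- by rewrite mxE /= /level /= mul0rn cos0 mulr1 rmorph_nat.
Qed.

(** The polar coordinates are left free, to serve both H_T(h) with its energies and [H1], that is h
    = 0, in the closed form E = 2 with [ising_angle]. *)
Lemma H1_ising (E a : 'I_L./2 -> R) (h : R) :
    (forall k, E k * cos (a k *+ 2) = 2 * (h - cos (q k))) ->
    (forall k, E k * sin (a k *+ 2) = 2 * sin (q k)) ->
  HT L h *m Phi = Phi *m total_ham E a.
Proof.
move=> Ec Es; rewrite mulmxDl (H1_even_sector L_gt1 (sector_embedding_parity R L_even)).
rewrite -mulmxDl (H1_modes R L_even L_gt1) (H2_modes R L_even L_gt1) scaler_sumr -big_split /=.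
rewrite mulmx_suml mulmx_sumr; apply: eq_bigr => k _.
rewrite -(sector_intertwine L_even L_gt1 (al := (2 * (h - cos (q k)))%:C)
  (be := - 2 * 'i * (sin (q k))%:C) (ga := 2 * 'i * (sin (q k))%:C) k).
- move: (pair_num _ _ _ _ k) (pair_raise _ _ _ k) (pair_lower _ _ _ k) => A B D.
  apply: (f_equal (fun X => X *m _)).
  have -> : (2 * (h - cos (q k)))%:C = 2 * (h%:C - (cos (q k))%:C) :> C.
    by rewrite rmorphM rmorphB rmorph_nat.
  move: h%:C (cos _)%:C (sin _)%:C => x y z.
  by apply/matrixP => i j; rewrite !mxE; ring.
- by rewrite mxE /= /level /= Ec rmorphN.
- by rewrite mxE /= /level /= Es rmorphN rmorphM rmorph_nat /=; ring.
- by rewrite mxE /= /level /= Es rmorphM rmorph_nat /=; ring.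
- by rewrite mxE /= /level /= Ec.
Qed.

Lemma HT_sector h :
  HT L h *m Phi = Phi *m total_ham (fun k => 2 * energy h k) (ground_angle h).
Proof.
by apply: H1_ising => k; rewrite -mulrA ?energy_cos ?energy_sin.
Qed.

Lemma H1_sector : H1 R L *m Phi = Phi *m total_ham (fun=> 2) ising_angle.
Proof.
have a2 k : ising_angle k *+ 2 = pi - q k by rewrite /ising_angle -mulr_natr; field.
have -> : H1 R L = HT L 0 by rewrite /HT scale0r addr0.
apply: H1_ising => k; rewrite a2; first by rewrite cosB cospi sinpi; ring.
by rewrite sinB cospi sinpi; ring.
Qed.

Fixpoint pair_vec (gamma beta : seq R) (p : nat) (k : 'I_L./2) : 'cV[C]_2 :=
  if p is j.+1 then
    evo 2 (ising_angle k) beta`_j *m (evo 2 0 gamma`_j *m pair_vec gamma beta j k)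
  else e0 R.

Lemma qaoa_stateE gamma beta p :
  qaoa_state L gamma beta p = Phi *m tensor_vec (pair_vec gamma beta p).
Proof.
elim: p => [|p IH] /=; first by rewrite -(sector_embedding_vacuum R L_even).
have E2 := evolution_tensor gamma`_p (pair_vec gamma beta p) (H2_adj R L) H2_sector.
have E1 := evolution_tensor beta`_p (fun k => evo 2 0 gamma`_p *m pair_vec gamma beta p k)
  (H1_adj R L) H1_sector.
by rewrite IH; exact: etrans (congr1 (mulmx _) E2) E1.
Qed.

Lemma pair_vec_unit gamma beta p k :
  (pair_vec gamma beta p k)^t* *m pair_vec gamma beta p k = 1%:M.
Proof.
elim: p => [|p IH] /=.
  apply/matrixP => i j; rewrite !ord1 !mxE sum_I2 !mxE /=.
  by rewrite rmorph1 rmorph0 !mulr1 mulr0 addr0.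
by rewrite !evo_isometry.
Qed.

End Sector.

(** * The sector ground state overlaps |+...+> *)

Section PerronFrobenius.
Variables (R : realType) (n : nat).
Local Notation C := R[i].

(** Expand [v] in an eigenbasis of [A]. If an eigenvector u lies below E, then u + Pu belongs to the
    sector and has the same eigenvalue, so it is 0. Hence Pu = -u, and u is orthogonal to [v]. *)
Lemma spectral_gap_sector (A P : 'M[C]_n) (E : R) :
    A^t* = A -> P^t* = P -> A *m P = P *m A -> P *m P = 1%:M ->
    (forall (E' : R) (v : 'cV[C]_n),
      v != 0 -> P *m v = v -> A *m v = E'%:C *: v -> E <= E') ->
  forall v : 'cV[C]_n, P *m v = v -> 0 <= (v^t* *m ((A - E%:C%:M) *m v)) 0 0.
Proof.
move=> hA hP AP PP Emin v Pv.
have hermA : A \is hermsymmx by apply/is_hermitianmxP; rewrite expr0 scale1r hA.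
have /orthomx_spectralP := hermitian_normalmx hermA.
rewrite invmx_unitary ?spectral_unitarymx //.
have /unitarymxP := spectral_unitarymx A.
have Dreal i : spectral_diag A 0 i = (complex.Re (spectral_diag A 0 i))%:C.
  by rewrite RRe_real //; apply: (mxOverP (hermitian_spectral_diag_real hermA)).
move: (spectralmx A) (spectral_diag A) Dreal => S D Dreal SS AE.
have SS' := mulmx1C SS.
have [y yE] : {y | y = S *m v} by exists (S *m v).
have vE : v = S^t* *m y by rewrite yE mulmxA SS' mul1mx.
have -> : (A - E%:C%:M) *m v = S^t* *m (\col_i ((D 0 i - E%:C) * y i 0)).
  rewrite mulmxBl mul_scalar_mx {2}vE {1}AE -!mulmxA -yE scalemxAr -mulmxBr; congr (_ *m _).
  by apply/matrixP => i j; rewrite ord1 mul_diag_mx !mxE mulrBl.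
rewrite mulmxA.
have -> : v^t* *m S^t* = y^t* by rewrite -mulmx_adj yE.
rewrite mxE sumr_ge0 // => i _; rewrite !mxE mulrCA.
have [Ei|iE] := leP E (complex.Re (D 0 i)).
  apply: mulr_ge0; first by rewrite Dreal -rmorphB /= ler0c subr_ge0.
  by rewrite mulrC mul_conjC_ge0.
suff -> : y i 0 = 0 by rewrite rmorph0 mul0r mulr0.
pose u : 'cV[C]_n := S^t* *m delta_mx i 0.
have Au : A *m u = D 0 i *: u.
  rewrite /u AE -!mulmxA [S *m (_ *m _)]mulmxA SS mul1mx scalemxAr; congr (_ *m _).
  apply/matrixP => j k; rewrite mul_diag_mx !mxE.
  by case: eqP => [->|_]; rewrite ?mulr0.
have w0 : u + P *m u = 0.
  apply: contraTeq iE => w0; rewrite -leNgt; apply: (Emin _ _ w0).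
    by rewrite mulmxDr mulmxA PP mul1mx addrC.
  by rewrite mulmxDr mulmxA AP -mulmxA Au -scalemxAr -scalerDr -Dreal.
have Pu : P *m u = - u by apply/eqP; rewrite -addr_eq0 addrC w0.
have uv : (u^t* *m v) 0 0 = y i 0.
  have -> : u^t* = row i S.
    rewrite /u mulmx_adj trmxCK; apply/matrixP => a b; rewrite ord1 !mxE (bigD1 i) //=.
    rewrite !mxE !eqxx rmorph1 mul1r big1 ?addr0 // => j /negbTE ji.
    by rewrite !mxE ji rmorph0 mul0r.
  by rewrite yE !mxE; apply: eq_bigr => j _; rewrite !mxE.
have : u^t* *m v = - (u^t* *m v).
  by rewrite -{1}Pv mulmxA -{1}hP -mulmx_adj Pu linearN /= map_mxN mulNmx.
move=> /matrixP/(_ 0 0); rewrite [RHS]mxE uv => /eqP.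
by rewrite -addr_eq0 -mulr2n mulrn_eq0 /= => /eqP.
Qed.

(* The modulus of a minimiser of a quadratic form with nonpositive off-diagonal
   entries is again a minimiser, so its zeros spread along nonzero entries. *)
Lemma minimiser_zero_spread (B : 'M[C]_n) (S : pred 'I_n) (x : 'cV[C]_n) :
    B^t* = B -> (forall a b, a != b -> B a b <= 0) ->
    (forall v : 'cV[C]_n, (forall a, ~~ S a -> v a 0 = 0) -> 0 <= (v^t* *m (B *m v)) 0 0) ->
    (forall a, ~~ S a -> x a 0 = 0) -> B *m x = 0 ->
  forall a b, S a -> a != b -> B a b != 0 -> x a 0 = 0 -> x b 0 = 0.
Proof.
move=> hB Bneg Bpos xS Bx a b Sa ab Bab xa.
have Breal c : B c c \is Num.real.
  by apply/CrealP; have /matrixP/(_ c c) := hB; rewrite !mxE.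
pose z : 'cV[C]_n := \col_c `|x c 0|.
have zS c : ~~ S c -> z c 0 = 0 by move=> /xS xc; rewrite mxE xc normr0.
have qE (v : 'cV[C]_n) : (v^t* *m (B *m v)) 0 0 = \sum_c \sum_d B c d * ((v c 0)^* * v d 0).
  rewrite mxE; apply: eq_bigr => c _; rewrite !mxE mulr_sumr.
  by apply: eq_bigr => d _; rewrite mulrCA.
(* Off the diagonal the entries of [B] are nonpositive, and a real part is at most a modulus, so the
   form at [z] is at most the form at [x], which is 0. *)
have qz : (z^t* *m (B *m z)) 0 0 = 0.
  apply/eqP; rewrite eq_le Bpos // andbT.
  have <- : 'Re ((x^t* *m (B *m x)) 0 0) = 0 by rewrite Bx mulmx0 mxE raddf0.
  rewrite !qE raddf_sum; apply: ler_sum => c _; rewrite raddf_sum; apply: ler_sum => d _.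
  rewrite /= !mxE conj_normC; have [->|cd] := eqVneq c d.
    rewrite ReMl // [X in _ <= _ * X](_ : _ = `|x d 0| * `|x d 0|) //.
    have -> : (x d 0)^* * x d 0 = `|x d 0| ^+ 2 by rewrite normCK mulrC.
    by rewrite (Creal_ReP _ _) ?expr2 // rpredX // normr_real.
  rewrite ReMl; last by rewrite realE Bneg // orbT.
  apply: ler_wnM2l; first exact: Bneg.
  by rewrite -[`|x c 0|]norm_conjC -normrM; apply: leif_Re_Creal.
pose y := B *m z.
have ya : y a 0 = \sum_c B a c * `|x c 0|.
  by rewrite mxE; apply: eq_bigr => c _; rewrite mxE.
have yneg c : B a c * `|x c 0| <= 0.
  have [<-|ac] := eqVneq a c; first by rewrite xa normr0 mulr0.
  by rewrite mulr_le0_ge0 // Bneg.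
have ya0 : y a 0 <= 0 by rewrite ya sumr_le0.
(* The form at [z] moved by t along the basis vector of [a]; this vector stays supported in [S]
   because [a] does. *)
have qt (t : C) : 0 <= t -> 0 <= t * y a 0 *+ 2 + t ^+ 2 * B a a.
  move=> t0; have tr : t^* = t by apply/CrealP; exact: ger0_real.
  pose e : 'cV[C]_n := delta_mx a 0.
  have eV (v : 'cV[C]_n) : (e^t* *m v) 0 0 = v a 0.
    rewrite mxE (bigD1 a) //= !mxE !eqxx rmorph1 mul1r big1 ?addr0 // => j /negbTE ja.
    by rewrite !mxE ja rmorph0 mul0r.
  have te : (t *: e)^t* = t *: e^t*.
    by apply/matrixP => i j; rewrite !mxE rmorphM; congr (_ * _); exact: tr.
  have T0 : (e^t* *m (B *m e)) 0 0 = B a a.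
    rewrite eV mxE (bigD1 a) //= !mxE !eqxx mulr1 big1 ?addr0 // => j /negbTE ja.
    by rewrite !mxE ja mulr0.
  have Q0 : (e^t* *m (B *m z)) 0 0 = y a 0 by rewrite eV.
  have S0 : (z^t* *m (B *m e)) 0 0 = y a 0.
    have -> : z^t* *m (B *m e) = (e^t* *m (B *m z))^t*.
      by rewrite mulmx_adj trmxCK mulmx_adj hB mulmxA.
    have yr : (y a 0)^* = y a 0 by apply/CrealP; exact: ler0_real.
    by rewrite mxE mxE Q0.
  have : 0 <= ((z + t *: e)^t* *m (B *m (z + t *: e))) 0 0.
    apply: Bpos => c Sc; rewrite !mxE xS // normr0 add0r.
    by case: eqP Sc => [->|_ _]; rewrite ?Sa // mulr0.
  have -> : (z + t *: e)^t* *m (B *m (z + t *: e)) =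
      z^t* *m (B *m z) + t *: (e^t* *m (B *m z)) + t *: (z^t* *m (B *m e))
      + t ^+ 2 *: (e^t* *m (B *m e)).
    rewrite linearD /= map_mxD te !(mulmxDr, mulmxDl) -!scalemxAr -!scalemxAl.
    move: (z^t* *m (B *m z)) (e^t* *m (B *m z)) (z^t* *m (B *m e)) (e^t* *m (B *m e)).
    by move=> P Q U V; apply/matrixP => i j; rewrite !mxE; ring.
  move: (z^t* *m _) (e^t* *m _) (z^t* *m _) (e^t* *m _) qz Q0 S0 T0 => P Q U V P0 Q0 S0 T0.
  move: (y a 0) (B a a) Q0 S0 T0 => w r Q0 S0 T0.
  by rewrite !mxE P0 Q0 S0 T0 add0r mulr2n.
have {}ya0 : y a 0 = 0.
  apply/eqP; rewrite eq_le ya0 /=; pose m := - y a 0.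
  have m0 : 0 <= m by rewrite oppr_ge0.
  have M0 : 0 < 1 + `|B a a| by rewrite ltr_wpDr.
  have [m_gt0|] := boolP (0 < m); last first.
    by rewrite lt_def m0 andbT negbK /m oppr_eq0 => /eqP ->.
  (* Small enough for [t * B a a <= m], so that the linear term -2m would make the form negative;
     the summand 1 keeps the denominator positive. *)
  pose t := m / (1 + `|B a a|).
  have t0 : 0 < t by rewrite divr_gt0.
  have := qt t (ltW t0); rewrite expr2 -mulrA -mulrnAr -mulrDr pmulr_rge0 //.
  have tB : t * B a a <= m.
    apply: (@le_trans _ _ (t * `|B a a|)).
      by rewrite ler_pM2l // real_ler_norm.
    rewrite /t mulrAC ler_pdivrMr // ler_pM2l // ler_wpDl //.
  have -> : y a 0 = - m by rewrite opprK.
  move=> H; have := le_trans H (lerD (lexx _) tB).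
  by rewrite mulr2n addrNK oppr_ge0 oppr_le0.
(* As [x a 0] is 0, the diagonal term is absent: the vanishing [y a 0] is a sum of nonpositive
   terms, each of which must vanish. *)
have Bx0 : B a b * `|x b 0| = 0.
  move/eqP: ya0; rewrite ya; rewrite -oppr_eq0 -sumrN psumr_eq0; last first.
    by move=> c _; rewrite oppr_ge0.
  by move=> /allP/(_ b (mem_index_enum b)); rewrite oppr_eq0 => /eqP.
by move/eqP: Bx0; rewrite mulf_eq0 (negbTE Bab) normr_eq0 => /eqP.
Qed.

End PerronFrobenius.

(** * H_T(h) in the X basis and its connectivity *)

Section XBasis.
Variables (R : realType) (L : nat).
Hypothesis L_gt1 : (1 < L)%N.
Local Notation C := R[i].
Local Notation sx := (pauliX R).
Local Notation sz := (pauliZ R).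

Definition hadamard : 'M[C]_2 :=
  \matrix_(a, b) (((Num.sqrt 2)^-1)%:C * (if (a == 1) && (b == 1) then -1 else 1)).

Let r2 : C := ((Num.sqrt 2)^-1)%:C.

Lemma r2_sqr : r2 * r2 * 2 = 1.
Proof.
have -> : 2 = 2%:C :> C by rewrite rmorph_nat.
rewrite /r2 -!rmorphM /= -invfM -expr2 sqr_sqrtr // mulVf //.
Qed.

Lemma hadamardK : hadamard *m hadamard = 1%:M.
Proof.
apply: mx2P => j; case: (I2P j) => ->; rewrite !mxE sum_I2 !mxE /= -/r2.
- by transitivity (r2 * r2 * 2); [ring|exact: r2_sqr].
- by ring.
- by ring.
- by transitivity (r2 * r2 * 2); [ring|exact: r2_sqr].
Qed.

Lemma hadamard_X : hadamard *m sx *m hadamard = sz.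
Proof.
suff -> : hadamard *m sx = sz *m hadamard by rewrite -mulmxA hadamardK mulmx1.
by apply: mx2P => j; case: (I2P j) => ->; rewrite !mxE !sum_I2 !mxE /= -/r2; ring.
Qed.

Lemma hadamard_Z : hadamard *m sz *m hadamard = sx.
Proof. by rewrite -hadamard_X !mulmxA hadamardK mul1mx -mulmxA hadamardK mulmx1. Qed.

Lemma hadamard_adj : hadamard^t* = hadamard.
Proof.
apply: mx2P => j; case: (I2P j) => ->; rewrite !mxE /= -/r2 rmorphM ?rmorphN rmorph1;
  by congr (_ * _); rewrite -[RHS]conjc_real.
Qed.

Definition Had : 'M[C]_(qdim L) := tensor_mx (fun=> hadamard).

Lemma HadK : Had *m Had = 1%:M.
Proof. by rewrite tensor_mxM -tensor_mx1; apply: eq_tensor_mx => i; rewrite hadamardK. Qed.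

Lemma Had_adj : Had^t* = Had.
Proof. by rewrite tensor_mx_adj; apply: eq_tensor_mx => i; rewrite hadamard_adj. Qed.

Lemma Had_site (M : 'M[C]_2) j :
  Had *m at_site M j *m Had = at_site (hadamard *m M *m hadamard) j.
Proof.
rewrite !tensor_mxM; apply: eq_tensor_mx => i; case: eqP => // _.
by rewrite mulmx1 hadamardK.
Qed.

Lemma Had_mul (A B : 'M[C]_(qdim L)) :
  Had *m (A *m B) *m Had = (Had *m A *m Had) *m (Had *m B *m Had).
Proof. by rewrite [RHS]mulmxA -[Had *m A *m Had *m _]mulmxA [Had *m (Had *m B)]mulmxA HadK mul1mx mulmxA. Qed.

(* In the X basis the off-diagonal entries are nonpositive for every sign of h. *)
Definition HX (h : R) : 'M[C]_(qdim L) := Had *m HT L h *m Had.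

Lemma HXE h : HX h = - (\sum_j X_ R j *m X_ R (ordS j)) - h%:C *: \sum_j Z_ R j.
Proof.
rewrite /HX mulmxDr mulmxDl; congr (_ + _).
  rewrite mulmxN mulNmx mulmx_sumr mulmx_suml; congr (- _); apply: eq_bigr => j _.
  by rewrite Had_mul !Had_site !hadamard_Z.
rewrite -scalemxAr -scalemxAl mulmxN mulNmx scalerN; congr (- (_ *: _)).
rewrite mulmx_sumr mulmx_suml; apply: eq_bigr => j _.
by rewrite Had_site hadamard_X.
Qed.

Definition sgn (s : {ffun 'I_L -> 'I_2}) : C := \prod_j (-1) ^+ s j.

Lemma Had_parity : Had *m parity R L *m Had = diag_mx (\row_a sgn (bits a)).
Proof.
rewrite parityE !tensor_mxM.
have -> : tensor_mx (fun=> hadamard *m sx *m hadamard) = tensor_mx (fun=> sz) :> 'M[C]_(qdim L).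
  by apply: eq_tensor_mx => i; rewrite hadamard_X.
apply/matrixP => a b; rewrite !mxE -mulr_natr -(can_eq (@enum_valK _) a b).
rewrite -[X in _ * X]prod_delta -big_split; apply: eq_bigr => k _.
by rewrite !mxE /= mulr_natr.
Qed.

Lemma X_ge0 j (a b : 'I_(qdim L)) : 0 <= X_ R j a b.
Proof.
rewrite mxE prodr_ge0 // => i _; case: eqP => _; rewrite !mxE ler0n //.
Qed.

Lemma XX_ge0 j k (a b : 'I_(qdim L)) : 0 <= (X_ R j *m X_ R k) a b.
Proof. by rewrite mxE sumr_ge0 // => c _; rewrite mulr_ge0 // X_ge0. Qed.

Lemma Z_offdiag j (a b : 'I_(qdim L)) : a != b -> Z_ R j a b = 0.
Proof.
move=> ab; have [i abi] : exists i, bits a i != bits b i.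
  apply/existsP; move: ab; apply: contraNT; rewrite negb_exists => /forallP ab.
  apply/eqP/(can_inj (@enum_valK _))/ffunP => i.
  by apply/eqP; rewrite -[_ == _]negbK.
rewrite mxE (bigD1 i) //=; case: eqP => _; rewrite !mxE (negbTE abi) ?mulr0n mul0r //.
Qed.

Lemma HX_offdiag h (a b : 'I_(qdim L)) : a != b ->
  HX h a b = - \sum_j (X_ R j *m X_ R (ordS j)) a b.
Proof.
move=> ab; rewrite HXE !mxE !summxE [X in _ * X]big1 ?mulr0 ?subr0 //.
by move=> j _; rewrite Z_offdiag.
Qed.

(** The transition made by the bond term of j in the X basis. These moves connect all bit strings of
    sign 1. *)
Definition flip (j : 'I_L) (s : {ffun 'I_L -> 'I_2}) : {ffun 'I_L -> 'I_2} :=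
  [ffun i => if (i == j) || (i == ordS j) then (if s i == 0 then 1 else 0) else s i].

Lemma ordS_neq (j : 'I_L) : ordS j != j.
Proof.
rewrite -val_eqE /=; have jL := ltn_ord j; have [jS|jS] := ltnP j.+1 L.
  by rewrite modn_small // gtn_eqF.
have -> : j.+1 = L by apply/eqP; rewrite eqn_leq jS jL.
by rewrite modnn; apply/eqP => j0; move: jS; rewrite -j0 leqNgt L_gt1.
Qed.

Lemma flipK j s : flip j (flip j s) = s.
Proof.
apply/ffunP => i; rewrite !ffunE; case: ((i == j) || (i == ordS j)) => //.
by case: (I2P (s i)) => ->; rewrite eqxx.
Qed.

Lemma sgn_flip j s : sgn (flip j s) = sgn s.
Proof.
have Sj := ordS_neq j.
have f1 (x : 'I_2) : (-1 : C) ^+ (if x == 0 then 1 else 0 : 'I_2) = - (-1) ^+ x.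
  by case: (I2P x) => -> /=; rewrite ?expr0 ?expr1 ?opprK.
rewrite /sgn (bigD1 j) //= (bigD1 (ordS j)) //= [RHS](bigD1 j) //= [X in _ = _ * X](bigD1 (ordS j)) //=.
rewrite !ffunE !eqxx orbT /= !f1 !mulrA mulrNN; congr (_ * _).
apply: eq_bigr => i /andP[ij iS]; by rewrite ffunE (negbTE ij) (negbTE iS).
Qed.

Lemma XX_flip j (a : 'I_(qdim L)) :
  (X_ R j *m X_ R (ordS j)) a (enum_rank (flip j (bits a))) = 1.
Proof.
rewrite tensor_mxM mxE big1 // => i _; rewrite /bits enum_rankK ffunE.
have Sj := ordS_neq j.
have xf (x : 'I_2) : sx x (if x == 0 then 1 else 0) = 1 by case: (I2P x) => ->; rewrite mxE.
have [->|ij] := eqVneq i j; first by rewrite eq_sym (negbTE Sj) mulmx1 xf.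
have [->|iS] := eqVneq i (ordS j); first by rewrite mul1mx xf.
by rewrite mul1mx mxE eqxx.
Qed.

(** In the X basis the overlap with |+...+> is the amplitude at the zero string. If it vanishes,
    flips spread the zero to every string of sign 1, and the remaining strings lie outside the
    sector. *)
Lemma sector_ground_overlap h (E : R) (G : 'cV[C]_(qdim L)) :
    (forall (E' : R) (v : 'cV[C]_(qdim L)),
        v != 0 -> parity R L *m v = v -> HT L h *m v = E'%:C *: v -> E <= E') ->
    parity R L *m G = G -> HT L h *m G = E%:C *: G ->
    (all_plus R L)^t* *m G = 0 ->
  G = 0.
Proof.
move=> Emin PG HG ov; pose x := Had *m G.
have GE : G = Had *m x by rewrite mulmxA HadK mul1mx.
pose S : pred 'I_(qdim L) := fun a => sgn (bits a) == 1.
have DS (v : 'cV[C]_(qdim L)) : parity R L *m (Had *m v) = Had *m v <->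
    (forall a, ~~ S a -> v a 0 = 0).
  have E0 : Had *m (parity R L *m (Had *m v)) = diag_mx (\row_a sgn (bits a)) *m v.
    by rewrite !mulmxA Had_parity.
  split=> [Pv a|vS].
    have : (diag_mx (\row_a sgn (bits a)) *m v) a 0 = v a 0.
      by rewrite -E0 Pv mulmxA HadK mul1mx.
    rewrite mul_diag_mx !mxE => /eqP; rewrite -subr_eq0 -{2}[v a 0]mul1r -mulrBl mulf_eq0 subr_eq0.
    by rewrite /S => /orP[->//|/eqP].
  rewrite -[LHS]mul1mx -HadK -mulmxA E0; congr (_ *m _).
  apply/matrixP => a j; rewrite ord1 mul_diag_mx !mxE.
  by have [/eqP ->|/vS ->] := boolP (S a); rewrite ?mul1r ?mulr0.
have xS : forall a, ~~ S a -> x a 0 = 0 by apply/DS; rewrite -GE.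
pose B := HX h - E%:C%:M.
have hB : B^t* = B.
  rewrite /B linearB /= map_mxB /HX !mulmx_adj Had_adj HT_adj mulmxA; congr (_ - _).
  by rewrite tr_scalar_mx map_scalar_mx; congr (_%:M); exact: conjc_real.
have Boff a b : a != b -> B a b = - \sum_j (X_ R j *m X_ R (ordS j)) a b.
  by move=> ab; rewrite mxE HX_offdiag // !mxE (negbTE ab) mulr0n oppr0 addr0.
have Bneg a b : a != b -> B a b <= 0.
  by move=> ab; rewrite Boff // oppr_le0 sumr_ge0 // => j _; exact: XX_ge0.
have BE (v : 'cV[C]_(qdim L)) : B *m v = Had *m ((HT L h - E%:C%:M) *m (Had *m v)).
  rewrite /B /HX !mulmxBl mulmxBr !mul_scalar_mx -scalemxAr [Had *m (Had *m v)]mulmxA HadK mul1mx.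
  by rewrite !mulmxA.
have Bpos (v : 'cV[C]_(qdim L)) : (forall a, ~~ S a -> v a 0 = 0) ->
    0 <= (v^t* *m (B *m v)) 0 0.
  move=> /DS Pv.
  have -> : v^t* *m (B *m v) = (Had *m v)^t* *m ((HT L h - E%:C%:M) *m (Had *m v)).
    by rewrite BE mulmx_adj Had_adj !mulmxA.
  exact: (spectral_gap_sector (HT_adj L h) (parity_adj R L) (HT_parity L h) (parityK R L) Emin Pv).
have Bx : B *m x = 0.
  by rewrite BE -GE mulmxBl HG mul_scalar_mx subrr mulmx0.
have spread := minimiser_zero_spread hB Bneg Bpos xS Bx.
pose xs s := x (enum_rank s) 0.
have xsE a : x a 0 = xs (bits a) by rewrite /xs /bits enum_valK.
have xflip j s : sgn s = 1 -> xs (flip j s) = 0 -> xs s = 0.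
  move=> s1 fs; rewrite -(flipK j s).
  have Sf : S (enum_rank (flip j s)) by rewrite /S /bits enum_rankK sgn_flip s1.
  pose a := enum_rank (flip j s); pose b := enum_rank (flip j (flip j s)).
  have ab : a != b.
    rewrite (inj_eq enum_rank_inj); apply/eqP => /ffunP/(_ j).
    by rewrite !ffunE !eqxx /=; case: (I2P (s j)) => ->.
  apply: (spread a b Sf ab) => //.
  rewrite Boff // oppr_eq0 gt_eqF // (bigD1 j) //= ltr_pwDl //; last first.
    by rewrite sumr_ge0 // => k _; exact: XX_ge0.
  have -> : b = enum_rank (flip j (bits a)) by rewrite /bits enum_rankK.
  by rewrite XX_flip.
have x0 : xs [ffun=> 0] = 0.
  have /matrixP/(_ 0 0) := ov; rewrite !mxE => ov0; rewrite /xs mxE -[RHS]ov0.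
  apply: eq_bigr => b _; congr (_ * _); rewrite !mxE rmorph_prod; apply: eq_bigr => j _.
  by rewrite /bits enum_rankK ffunE !mxE /= mulr1; exact: (esym (conjc_real _)).
(* Strings supported on the last m + 1 sites. A 1 at the first of these sites is pushed to the right
   by a flip; when only the last site is left, the sign forbids a single 1. *)
have all0 m s : sgn s = 1 -> (forall i : 'I_L, (i < L - m.+1)%N -> s i = 0) -> xs s = 0.
  elim: m s => [|m IH] s s1 sz0.
    suff -> : s = [ffun=> 0] by [].
    have LL : (L.-1 < L)%N by rewrite prednK // ltnW.
    have s0 (i : 'I_L) : i != Ordinal LL -> s i = 0.
      move=> iL; apply: sz0; rewrite subn1; move: iL; rewrite -val_eqE /= => iL.
      by rewrite ltn_neqAle iL /= -ltnS prednK // ltnW.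
    apply/ffunP => i; rewrite ffunE; have [->|/s0 //] := eqVneq i (Ordinal LL).
    case: (I2P (s (Ordinal LL))) => // sl.
    move: s1; rewrite /sgn (bigD1 (Ordinal LL)) //= sl expr1 big1 ?mulr1.
      move=> m1; have /eqP : 2%:R = 0 :> C by rewrite mulr2n -{1}m1 addNr.
      by rewrite pnatr_eq0.
    by move=> l /s0 ->.
  (* Once m + 1 reaches L, the truncated subtraction gives 0, and the induction hypothesis already
     covers all strings. *)
  have [Lm|mL] := leqP L m.+1.
    apply: IH => // i; have -> : (L - m.+1 = 0)%N by apply/eqP; rewrite subn_eq0.
    by [].
  have jL : (L - m.+2 < L)%N by rewrite ltn_subrL (ltn_trans _ L_gt1).
  pose j := Ordinal jL.
  have jE : (L - m.+1 = (L - m.+2).+1)%N by lia.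
  have zero s' : (forall i : 'I_L, (i < L - m.+2)%N -> s' i = 0) -> s' j = 0 ->
      forall i : 'I_L, (i < L - m.+1)%N -> s' i = 0.
    move=> z1 z2 i; rewrite jE ltnS leq_eqVlt => /predU1P[ij|/z1 //].
    by have -> : i = j by apply/val_inj.
  case: (I2P (s j)) => sj; first by apply: IH => //; apply: zero.
  apply: (xflip j _ s1); apply: IH; first by rewrite sgn_flip.
  have Sj : ordS j = (L - m.+1)%N :> nat by rewrite /= -jE modn_small //; lia.
  apply: zero => [i iL|]; last by rewrite ffunE eqxx sj.
  rewrite ffunE -[i == j]val_eqE -[i == ordS j]val_eqE [val (ordS j)]Sj jE /=.
  by rewrite !ltn_eqF ?sz0 // ltnW.
rewrite GE; have -> : x = 0; last by rewrite mulmx0.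
apply/matrixP => a j; rewrite ord1 [RHS]mxE.
have [/eqP Sa|/xS //] := boolP (S a); rewrite xsE.
apply: (all0 L) => // i; rewrite (_ : (L - L.+1 = 0)%N) //.
by apply/eqP; rewrite subn_eq0.
Qed.

End XBasis.

(** * The Moebius recursion as a ratio of amplitudes *)

Section Ratios.
Variable R : realType.
Local Notation C := R[i].

Definition ratio (x : 'cV[C]_2) : sphere R :=
  if x 0 0 == 0 then None else Some (x 1 0 / x 0 0).

Lemma cV2_neq0 (x : 'cV[C]_2) : x != 0 -> x 0 0 = 0 -> x 1 0 != 0.
Proof.
move=> x0 x00; apply: contraNneq x0 => x10; apply/eqP.
by apply: mx2P => j; rewrite !ord1 ?x00 ?x10 mxE.
Qed.

(** A Moebius map is linear in homogeneous coordinates; l is the common factor that the ratio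
    forgets. *)
Lemma mobius_ratio (a b c d l : C) (x y : 'cV[C]_2) :
    l != 0 -> x != 0 ->
    y 0 0 = l * (c * x 1 0 + d * x 0 0) -> y 1 0 = l * (a * x 1 0 + b * x 0 0) ->
  mobius a b c d (ratio x) = ratio y.
Proof.
move=> l0 x0 y0 y1; rewrite /ratio y0 y1; case: eqP => [x00|/eqP x00] /=.
  have x10 := cV2_neq0 x0 x00.
  rewrite x00 !mulr0 !addr0 mulf_eq0 (negbTE l0) /= mulf_eq0 (negbTE x10) orbF.
  by case: eqP => // /eqP c0; congr Some; field; rewrite l0 x10 c0.
have -> : c * (x 1 0 / x 0 0) + d = (c * x 1 0 + d * x 0 0) / x 0 0 by field.
have -> : a * (x 1 0 / x 0 0) + b = (a * x 1 0 + b * x 0 0) / x 0 0 by field.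
rewrite !mulf_eq0 (negbTE l0) invr_eq0 (negbTE x00) orbF /=.
by case: eqP => // /eqP cd; congr Some; field; rewrite l0 x00 cd.
Qed.

Lemma rotE a (x : 'cV[C]_2) :
  ((rot a *m x) 0 0 = (cos a)%:C * x 0 0 + 'i * (sin a)%:C * x 1 0) *
  ((rot a *m x) 1 0 = 'i * (sin a)%:C * x 0 0 + (cos a)%:C * x 1 0).
Proof. by split; rewrite !mxE sum_I2 !mxE. Qed.

Lemma rot_neq0 a (x : 'cV[C]_2) : x != 0 -> rot a *m x != 0.
Proof.
by apply: contra_neq => E; rewrite -[x]mul1mx -(rotNK a) -mulmxA E mulmx0.
Qed.

Lemma rot_evo E a t (x : 'cV[C]_2) :
  rot (- a) *m (evo E a t *m x) =
  diag_mx (\row_y expi (- (t * level E y))) *m (rot (- a) *m x).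
Proof. by rewrite /evo !mulmxA rotNK mul1mx. Qed.

(** The levels differ by 2E; as E = 2 for [H1] and [H2], this is the 4 in e^{-4i gamma} and e^{-4i
    beta}. *)
Lemma rotate_ratio (t E : R) (x : 'cV[C]_2) : x != 0 ->
  rotate (- (2 * E * t)) (ratio x) = ratio (diag_mx (\row_y expi (- (t * level E y))) *m x).
Proof.
move=> x0; apply: (@mobius_ratio _ _ _ _ (expi (t * E))) => //.
- by rewrite -normr_gt0 norm_expi.
- by rewrite mul_diag_mx !mxE /level /= mulrN opprK mul0r add0r mul1r.
- rewrite mul_diag_mx !mxE /level /= mul0r addr0 mulrA -expiD; congr (expi _ * _); ring.
Qed.

End Ratios.

(** * The recursion and the projection in terms of block eigenbases *)

Section Recursion.
Variables (R : realType) (L : nat).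
Hypothesis L_even : ~~ odd L.
Hypothesis L_gt1 : (1 < L)%N.
Local Notation C := R[i].
Local Notation q k := (momentum R L k).
Local Notation b k := (ising_angle R k).

Lemma half_momentum (k : 'I_L./2) :
  [/\ 0 < sin (q k / 2), 0 < cos (q k / 2),
      cos (b k) = sin (q k / 2) & sin (b k) = cos (q k / 2)].
Proof.
have /andP[q0 qpi] := momentum_bounds R L_even L_gt1 k.
have h0 : 0 < q k / 2 by rewrite divr_gt0.
have hpi : q k / 2 < pi / 2 by rewrite ltr_pM2r // invr_gt0.
split.
- by apply: sin_gt0_pihalf; rewrite h0 hpi.
- apply: cos_gt0_pihalf; rewrite hpi andbT; apply: lt_trans h0.
  by rewrite oppr_lt0 divr_gt0 ?pi_gt0.
- by rewrite /ising_angle cosB cos_pihalf sin_pihalf mul0r add0r mul1r.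
- by rewrite /ising_angle sinB cos_pihalf sin_pihalf mul0r subr0 mul1r.
Qed.

Lemma itan_cos (k : 'I_L./2) :
  'i * (cos (q k / 2))%:C * itan (q k) = - (sin (q k / 2))%:C :> C.
Proof.
have [_ c0 _ _] := half_momentum k.
rewrite /itan /tan rmorphM fmorphV /= mulrACA ii mulN1r mulrCA mulfV ?mulr1 //.
by rewrite (inj_eq (@complexI R)) gt_eqF.
Qed.

(** The change from the eigenbasis of [H1] to that of [H2], whose angle is 0. Multiplied by i
    cos(q/2), the coefficients 1 and -i tan(q/2) become i cos(q/2) and sin(q/2), the entries of
    [rot]. *)
Lemma mobius_gamma (k : 'I_L./2) (x : 'cV[C]_2) : x != 0 ->
  mobius (- itan (q k)) 1 1 (- itan (q k)) (ratio x) = ratio (rot (b k) *m x).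
Proof.
move=> x0; have [s0 c0 cb sb] := half_momentum k; have sE := itan_cos k.
move/eqP: sE; rewrite -eqr_oppLR eq_sym => /eqP sE.
apply: (@mobius_ratio _ _ _ _ _ ('i * (cos (q k / 2))%:C)) => //.
- by rewrite mulf_neq0 ?neq0Ci // (inj_eq (@complexI R)) gt_eqF.
- by rewrite rotE cb sb sE; ring.
- by rewrite rotE cb sb sE; ring.
Qed.

Lemma mobius_beta (k : 'I_L./2) (x : 'cV[C]_2) : x != 0 ->
  mobius (itan (q k)) 1 1 (itan (q k)) (ratio x) = ratio (rot (- b k) *m x).
Proof.
move=> x0; have [s0 c0 cb sb] := half_momentum k; have sE := itan_cos k.
move/eqP: sE; rewrite -eqr_oppLR eq_sym => /eqP sE.
apply: (@mobius_ratio _ _ _ _ _ (- ('i * (cos (q k / 2))%:C))) => //.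
- by rewrite oppr_eq0 mulf_neq0 ?neq0Ci // (inj_eq (@complexI R)) gt_eqF.
- by rewrite rotE cosN sinN cb sb rmorphN sE; ring.
- by rewrite rotE cosN sinN cb sb rmorphN sE; ring.
Qed.

Lemma pair_vec_neq0 (gamma beta : seq R) p (k : 'I_L./2) : pair_vec gamma beta p k != 0.
Proof.
apply/eqP => v0; have := pair_vec_unit gamma beta p k.
rewrite v0 mulmx0 => /matrixP/(_ 0 0); rewrite !mxE eqxx => /esym/eqP.
by rewrite oner_eq0.
Qed.

Lemma evo_neq0 E a t (x : 'cV[C]_2) : x != 0 -> evo E a t *m x != 0.
Proof.
apply: contra_neq => ex.
by rewrite -[x]mul1mx -(evo_unitary E a t) -mulmxA ex mulmx0.
Qed.

Lemma f_evenE (gamma beta : seq R) (k : 'I_L./2) p :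
  f_even gamma beta (q k) p = ratio (rot (- b k) *m pair_vec gamma beta p k).
Proof.
have [s0 c0 cb sb] := half_momentum k.
elim: p => [|p IH] /=.
  (* In the eigenbasis of [H1] the vacuum has components sin(q/2) and -i cos(q/2), whose ratio is
     the initial value 1 / (i tan(q/2)). *)
  rewrite /ratio !rotE !mxE /= !mulr1 !mulr0 !addr0 cosN sinN cb sb.
  rewrite (inj_eq (@complexI R)) gt_eqF //; congr Some.
  have it0 : itan (q k) != 0 :> C.
    rewrite mulf_neq0 ?neq0Ci // (inj_eq (@complexI R)).
    by rewrite gt_eqF // divr_gt0.
  have s0' : (sin (q k / 2))%:C != 0 :> C by rewrite (inj_eq (@complexI R)) gt_eqF.
  apply: (mulIf it0); rewrite mulVf // mulrAC rmorphN mulrN mulNr itan_cos opprK.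
  by rewrite mulfV.
have pv0 := pair_vec_neq0 gamma beta p k.
set v := pair_vec gamma beta p k in IH pv0 *.
rewrite /gamma_step /beta_step IH mobius_gamma ?rot_neq0 // mulmxA rotK mul1mx.
have -> : 4 * gamma`_p = 2 * 2 * gamma`_p by ring.
have -> : 4 * beta`_p = 2 * 2 * beta`_p by ring.
rewrite rotate_ratio //.
have -> : diag_mx (\row_y expi (- (gamma`_p * level 2 y))) = evo 2 0 gamma`_p.
  by rewrite /evo oppr0 rot0 mul1mx mulmx1.
have ev0 : evo 2 0 gamma`_p *m v != 0 by exact: evo_neq0.
rewrite (mobius_beta k ev0) (rotate_ratio _ _ (rot_neq0 _ ev0)).
by rewrite -(rot_evo 2 (b k) beta`_p).
Qed.

(** Since q lies in (0, pi), arctan(cot q) is pi/2 - q, and half the sum of the two arctangents is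
    [ising_angle] minus [ground_angle]. It lies in (-pi/2, pi/2), so its cosine is positive. *)
Lemma Kh0E h (k : 'I_L./2) :
  cos (ground_angle h k - b k) != 0 /\
  Kh0 h (q k) = - tan (ground_angle h k - b k).
Proof.
have /andP[q0 qpi] := momentum_bounds R L_even L_gt1 k.
have s0 := sin_momentum_gt0 R L_even L_gt1 k.
have acot : atan (cos (q k) / sin (q k)) = pi / 2 - q k.
  have -> : cos (q k) / sin (q k) = tan (pi / 2 - q k).
    by rewrite /tan sinB cosB sin_pihalf cos_pihalf !mul0r !mul1r subr0 add0r.
  rewrite tanK // in_itv /=; apply/andP; split; lra.
rewrite /Kh0 -/(gap_angle h k) acot.
have -> : ground_angle h k - b k = - ((gap_angle h k + (pi / 2 - q k)) / 2).
  by rewrite /ground_angle /ising_angle; field.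
rewrite tanN opprK cosN; split => //.
have g1 := atan_gtNpi2 ((h - cos (q k)) / sin (q k)).
have g2 := atan_ltpi2 ((h - cos (q k)) / sin (q k)).
rewrite gt_eqF //; apply: cos_gt0_pihalf; rewrite /gap_angle.
by apply/andP; split; lra.
Qed.

Lemma f_proj_eq0 h (gamma beta : seq R) p (k : 'I_L./2) :
  f_proj h gamma beta p (q k) = Some 0 <->
  (rot (- ground_angle h k) *m pair_vec gamma beta p k) 1 0 = 0.
Proof.
have [c0 KE] := Kh0E h k.
rewrite /f_proj f_evenE KE; set a := ground_angle h k - b k in c0 KE *.
have pv0 := pair_vec_neq0 gamma beta p k.
set v := rot (- ground_angle h k) *m pair_vec gamma beta p k.
have v0 : v != 0 by exact: rot_neq0.
have -> : rot (- b k) *m pair_vec gamma beta p k = rot a *m v.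
  by rewrite /v mulmxA rotD /a addrAC subrr add0r.
have c0' : (cos a)%:C != 0 :> C by rewrite (inj_eq (@complexI R)).
(* Multiplied by cos a, the coefficients 1 and iK become cos a and -i sin a: [f_proj] passes from
   the eigenbasis of [H1] to that of H_T(h). *)
have rm (w : 'cV[C]_2) : w != 0 ->
    mobius 1 ('i * (- tan a)%:C) ('i * (- tan a)%:C) 1 (ratio w) = ratio (rot (- a) *m w).
  move=> w0; apply: (@mobius_ratio _ _ _ _ _ (cos a)%:C) => //.
    by rewrite rotE cosN sinN !rmorphN /= /tan rmorphM fmorphV /=; field.
  by rewrite rotE cosN sinN !rmorphN /= /tan rmorphM fmorphV /=; field.
rewrite rm ?rot_neq0 //.
rewrite mulmxA rotNK mul1mx /ratio; case: eqP => [v00|/eqP v00]; split => //.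
- by move=> v10; have := cV2_neq0 v0 v00; rewrite v10 eqxx.
- by case=> /eqP; rewrite mulf_eq0 invr_eq0 (negbTE v00) orbF => /eqP.
- by move=> ->; rewrite mul0r.
Qed.

End Recursion.

(** * The ground state as a product of pairs *)

Section GroundState.
Variables (R : realType) (L : nat).
Hypothesis L_even : ~~ odd L.
Hypothesis L_gt1 : (1 < L)%N.
Local Notation C := R[i].
Local Notation Phi := (sector_embedding R L_even).

Definition ground_pair (h : R) (k : 'I_L./2) : 'cV[C]_2 := rot (ground_angle h k) *m e0 R.

Lemma total_level_min (h : R) (s : {ffun 'I_L./2 -> 'I_2}) :
  s != [ffun=> 0] ->
  total_level (fun k : 'I_L./2 => 2 * energy h k) [ffun=> 0] < total_level (fun k : 'I_L./2 => 2 * energy h k) s.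
Proof.
move=> s0; have [k sk] : exists k, s k != 0.
  apply/existsP; move: s0; apply: contraNT; rewrite negb_exists => /forallP s0.
  by apply/eqP/ffunP => i; rewrite ffunE; apply/eqP; rewrite -[_ == _]negbK.
have en (l : 'I_L./2) : 0 < 2 * energy h l by rewrite mulr_gt0 // energy_gt0.
rewrite /total_level (bigD1 k) //= [X in _ < X](bigD1 k) //=; apply: ltr_leD.
  by rewrite ffunE /level /= (negbTE sk) gtrN.
apply: ler_sum => j _; rewrite ffunE /level /=; case: ifP => // _.
by rewrite ltW // gtrN.
Qed.

Lemma eq_mx_iso (m n : nat) (A : 'M[C]_(n, m)) (v : 'cV[C]_m) :
  A^t* *m A = 1%:M -> (A *m v)^t* *m (A *m v) = v^t* *m v.
Proof. by move=> AA; rewrite mulmx_adj -mulmxA [_^t* *m (_ *m v)]mulmxA AA mul1mx. Qed.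

Lemma ground_stateE h G : is_sector_ground_state h G ->
  exists2 c : C, `|c| = 1 & G = c *: (Phi *m tensor_vec (ground_pair h)).
Proof.
case=> E [Gn PG HG Emin].
have iso := sector_embedding_iso R L_even L_gt1.
set hm := total_ham (fun k : 'I_L./2 => 2 * energy h k) (ground_angle h).
have HP : HT L h *m Phi = Phi *m hm := HT_sector L_even L_gt1 h.
have hmE : hm = Phi^t* *m HT L h *m Phi by rewrite -mulmxA HP mulmxA iso mul1mx.
have hm_adj : hm^t* = hm by rewrite hmE !mulmx_adj trmxCK HT_adj mulmxA.
(* Both matrices being Hermitian, the adjoint of the intertwining relation shows that projecting
   onto the image of [Phi] preserves eigenvectors. *)
have PH : Phi^t* *m HT L h = hm *m Phi^t*.
  by rewrite -hm_adj -mulmx_adj -HP mulmx_adj HT_adj.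
(* The difference is again in the sector and satisfies the eigenvalue equation for E; it is
   orthogonal to |+...+>, which lies in the image of [Phi]. *)
have GE : G = Phi *m (Phi^t* *m G).
  apply/eqP; rewrite -subr_eq0; apply/eqP.
  apply: (@sector_ground_overlap _ _ L_gt1 h E) => //.
  - by rewrite mulmxBr PG mulmxA sector_embedding_parity.
  - by rewrite mulmxBr HG mulmxA HP -mulmxA [hm *m _]mulmxA -PH -mulmxA HG -!scalemxAr scalerBr.
  - rewrite mulmxBr mulmxA.
    have -> : (all_plus R L)^t* *m Phi = (tensor_vec (fun=> \col_i (i == 0)%:R))^t*.
      by rewrite -(sector_embedding_vacuum R L_even) mulmx_adj -mulmxA iso mulmx1.
    by rewrite mulmxA -mulmx_adj (sector_embedding_vacuum R L_even) subrr.
pose U := total_rot (@ground_angle R L h).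
have UU : U *m U^t* = 1%:M := total_rotK _.
have UU' := mulmx1C UU.
have [y yE] : {y | y = U^t* *m (Phi^t* *m G)} by exists (U^t* *m (Phi^t* *m G)).
have GU : G = Phi *m (U *m y) by rewrite yE [U *m _]mulmxA UU mul1mx -GE.
pose lev s := total_level (fun k : 'I_L./2 => 2 * energy h k) s.
have hU : hm *m U = U *m diag_mx (\row_s (lev (bits s))%:C) by exact: total_ham_rot.
have yEig : diag_mx (\row_s (lev (bits s))%:C) *m y = E%:C *: y.
  rewrite -[LHS]mul1mx -UU' -mulmxA [U *m (_ *m y)]mulmxA -hU {1}yE -mulmxA [U *m _]mulmxA UU mul1mx.
  by rewrite [hm *m _]mulmxA -PH -mulmxA HG -!scalemxAr -yE.
have Elev s : E <= lev (bits s).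
  apply: (Emin _ (Phi *m (U *m delta_mx s 0))).
  - apply/eqP => v0; have := eq_mx_iso (U *m delta_mx s (0 : 'I_1)) iso.
    rewrite v0 mulmx0 (eq_mx_iso _ UU') => /matrixP/(_ 0 0); rewrite !mxE (bigD1 s) //=.
    rewrite !mxE !eqxx rmorph1 mul1r big1 ?addr0; first by move/eqP; rewrite eq_sym oner_eq0.
    by move=> j /negbTE js; rewrite !mxE js mulr0.
  - by rewrite mulmxA sector_embedding_parity.
  - rewrite mulmxA HP -mulmxA [hm *m _]mulmxA hU -mulmxA !scalemxAr; congr (_ *m (_ *m _)).
    apply/matrixP => i j; rewrite mul_diag_mx !mxE.
    by case: eqP => [->|_]; rewrite ?mulr0.
pose z0 := enum_rank ([ffun=> 0] : {ffun 'I_L./2 -> 'I_2}).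
(* A nonzero coordinate at s forces E to equal the level of s; for s other than [z0] this exceeds
   the lowest level, against [Elev]. *)
have ys s : s != z0 -> y s 0 = 0.
  move=> sz; apply/eqP; apply: contraTT sz => ys; rewrite negbK.
  have /matrixP/(_ s 0) := yEig; rewrite mul_diag_mx !mxE => /(mulIf ys)/complexI Es.
  apply: contraTT (Elev z0) => sz; rewrite -ltNge -Es /bits enum_rankK.
  apply: total_level_min; apply: contra_neq sz => bs.
  by rewrite /z0 -bs /bits enum_valK.
have yT : y = y z0 0 *: tensor_vec (fun=> e0 R).
  apply/matrixP => s j; rewrite ord1 !mxE.
  have -> : \prod_(k < L./2) e0 R (bits s k) 0 = (s == z0)%:R.
    rewrite -(can_eq (@enum_valK _) s z0) [enum_val z0]enum_rankK -prod_delta.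
    by apply: eq_bigr => k _; rewrite mxE ffunE.
  by case: eqVneq => [->|/ys ->]; rewrite ?mulr1 ?mulr0.
exists (y z0 0).
  have n1 : (G^t* *m G) 0 0 = 1.
    by rewrite -[RHS]Gn mxE; apply: eq_bigr => a _; rewrite !mxE normCK mulrC.
  have : `|y z0 0| ^+ 2 = 1.
    rewrite -n1 GU (eq_mx_iso _ iso) (eq_mx_iso _ UU') mxE (bigD1 z0) //=.
    rewrite !mxE normCK mulrC big1 ?addr0 // => s /ys ys0.
    by rewrite ys0 mulr0.
  by move/eqP; rewrite sqrp_eq1 // => /eqP.
by rewrite {1}GU {1}yT -!scalemxAr tensor_mxV.
Qed.

(** The entry at the zero string is nonzero, hence so is the product over the slots other than k.
    The entry with a single 1 at k is 0 and contains the same product. *)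
Lemma tensor_vec_vacuum_slot K (x : 'I_K -> 'cV[C]_2) (c : C) :
  c != 0 -> tensor_vec x = c *: tensor_vec (fun=> e0 R) -> forall k, x k 1 0 = 0.
Proof.
move=> c0 /matrixP xc k.
have xs (s : {ffun 'I_K -> 'I_2}) : \prod_j x j (s j) 0 = c * \prod_j e0 R (s j) 0.
  by have := xc (enum_rank s) 0; rewrite !mxE /bits enum_rankK.
have := xs [ffun=> 0]; rewrite [X in _ = _ * X]big1 => [|j _]; last by rewrite !mxE ffunE.
rewrite mulr1 (bigD1 k) //= => x0.
have xr : \prod_(j | j != k) x j ([ffun=> 0] j : 'I_2) 0 != 0.
  by apply: contraNneq c0 => r0; rewrite -x0 r0 mulr0.
have := xs (upd [ffun=> 0] k 1); rewrite [X in _ = _ * X](bigD1 k) //= !mxE ffunE eqxx mul0r mulr0.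
rewrite (bigD1 k) //= ffunE eqxx => /eqP; rewrite mulf_eq0 => /orP[/eqP //|].
move=> /eqP r0; case/eqP: xr; rewrite -[RHS]r0; apply: eq_bigr => j /negbTE jk.
by rewrite [in RHS]ffunE jk.
Qed.

Lemma qaoa_reaches_ground h G (gamma beta : seq R) p : is_sector_ground_state h G ->
  (exists2 z : C, `|z| = 1 & qaoa_state L gamma beta p = z *: G) <->
  (forall k : 'I_L./2, (rot (- ground_angle h k) *m pair_vec gamma beta p k) 1 0 = 0).
Proof.
move=> /ground_stateE[c c1 GE]; rewrite (qaoa_stateE L_even L_gt1).
have c0 : c != 0 by rewrite -normr_gt0 c1.
have iso := sector_embedding_iso R L_even L_gt1.
have [x xdef] : {x : 'I_L./2 -> 'cV[C]_2 |
    forall k, x k = rot (- ground_angle h k) *m pair_vec gamma beta p k}.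
  by exists (fun k => rot (- ground_angle h k) *m pair_vec gamma beta p k).
have wx (k : 'I_L./2) : pair_vec gamma beta p k = rot (ground_angle h k) *m x k.
  by rewrite xdef mulmxA rotK mul1mx.
split=> [[z z1]|x0].
  rewrite GE scalerA scalemxAr => /(congr1 (mulmx (Phi^t*))); rewrite !mulmxA iso !mul1mx => E.
  apply: (@tensor_vec_vacuum_slot _ _ (z * c)).
    by rewrite mulf_neq0 // -normr_gt0 z1.
  have := congr1 (mulmx (tensor_mx (fun k : 'I_L./2 => rot (- ground_angle h k)))) E.
  rewrite -scalemxAr !tensor_mxV => ->; congr (_ *: _); apply: eq_tensor_vec => k.
  by rewrite mulmxA rotNK mul1mx.
have xE k : x k = x k 0 0 *: e0 R.
  by apply: mx2P => j; rewrite ord1 !mxE /= ?mulr1 ?mulr0 // xdef x0.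
have xn k : `|x k 0 0| = 1.
  have : (x k)^t* *m x k = 1%:M.
    by rewrite xdef eq_mx_iso ?pair_vec_unit // rot_adj opprK rotK.
  move/matrixP/(_ 0 0); rewrite !mxE sum_I2 !mxE [x k 1 0](_ : _ = 0) ?mulr0 ?addr0; last by rewrite xdef x0.
  by rewrite mulrC -normCK eqxx => /eqP; rewrite sqrp_eq1 // => /eqP.
(* Each slot is proportional to its ground vector with its own unit factor; together these factors
   form the global phase. *)
exists ((\prod_k x k 0 0) / c).
  by rewrite normrM normfV c1 invr1 mulr1 normr_prod big1.
rewrite GE scalerA divfK // scalemxAr -tensor_vec_scale; congr (_ *m _).
by apply: eq_tensor_vec => k; rewrite wx {1}xE scalemxAr.
Qed.

End GroundState.

Theorem mainTheorem7 (R : realType) (L : nat) (h : R)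
    (G : 'cV[R[i]]_(qdim L)) :
  (2 <= L)%N -> ~~ odd L -> is_sector_ground_state h G ->
  (exists gamma beta : (L./2).-tuple R, exists2 z : R[i],
      `|z| = 1 & qaoa_state L gamma beta L./2 = z *: G)
  <->
  (exists gamma beta : (L./2).-tuple R,
      forall k : R, NSplus L k -> f_proj h gamma beta L./2 k = Some 0).
Proof.
move=> L_gt1 L_even GS.
(* The equivalence already holds for each fixed choice of the angles. *)
have key (gamma beta : (L./2).-tuple R) :
    (exists2 z : R[i], `|z| = 1 & qaoa_state L gamma beta L./2 = z *: G) <->
    (forall k : R, NSplus L k -> f_proj h gamma beta L./2 k = Some 0).
  split=> [/(qaoa_reaches_ground L_even L_gt1 _ _ _ GS) H k [n /= nL <-]|H].
    exact/(f_proj_eq0 L_even L_gt1 h _ _ _ (Ordinal nL))/H.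
  apply/(qaoa_reaches_ground L_even L_gt1 _ _ _ GS) => k.
  apply/(f_proj_eq0 L_even L_gt1); apply: H; exists (k : nat) => //=.
by split=> -[gamma [beta /key H]]; exists gamma, beta.
Qed.
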